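(* For $\omega\in\wedge^3\mathbb{C}^7$ consider the operator $\phi_\omega\colon\wedge^2\mathbb{C}^7\to\wedge^5\mathbb{C}^7$. The secant variety $\sigma_3(Gr(2,6))\subset\mathbb{P}(\wedge^3\mathbb{C}^7)$ is a hypersurface whose equation is given by an $SL(7)$-invariant homogeneous polynomial $P_7$ on $\wedge^3\mathbb{C}^7$ of degree seven such that $$\det(\phi_\omega)=2\,[P_7(\omega)]^3\qquad\text{for all }\omega\in\wedge^3\mathbb{C}^7 .$$
   Context: $Gr(2,6)\subset\mathbb{P}(\wedge^3\mathbb{C}^7)$ is the Plücker-embedded Grassmannian of $3$-dimensional linear subspaces of $\mathbb{C}^7$, and $\sigma_3(X)$ is the Zariski closure of the union of the linear spans of triples of points of $X$. The operator $\phi_\omega$ (called the contraction operator) is $\phi_\omega(v)=v\wedge\omega$ for $v\in\wedge^2\mathbb{C}^7$. Fix the standard basis $e_1,\dots,e_7$ of $\mathbb{C}^7$ and identify $\wedge^5\mathbb{C}^7$ with $(\wedge^2\mathbb{C}^7)^*$ via the wedge pairing and the volume form $e_1\wedge\cdots\wedge e_7$; then $\phi_\omega$ is a symmetric bilinear form on the $21$-dimensional space $\wedge^2\mathbb{C}^7$, $(v,v')\mapsto v\wedge v'\wedge\omega\in\wedge^7\mathbb{C}^7\cong\mathbb{C}$, and $\det(\phi_\omega)$ is the determinant of its $21\times21$ symmetric Gram matrix in the basis $\{e_i\wedge e_j\}_{i<j}$. $SL(7)=SL(7,\mathbb{C})$ acts on $\wedge^3\mathbb{C}^7$ in the natural way.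 *)

(* Defs.v *)
From HB Require Import structures.
From mathcomp Require Import all_boot all_order all_algebra.
From mathcomp Require Import mpoly complex reals.

Set Implicit Arguments.
Unset Strict Implicit.
Unset Printing Implicit Defensive.

Import Order.TTheory GRing.Theory Num.Theory.
Local Open Scope ring_scope.

(* [ext K n k] is the exterior power /\^k K^n, given by coordinates in the
   basis e_A = e_{a_1} /\ ... /\ e_{a_k}, where A = {a_1 < ... < a_k} ranges
   over the k-element subsets of {0, ..., n-1}. *)
Definition ksub (n k : nat) := {A : {set 'I_n} | #|A| == k}.
Definition ext (K : fieldType) (n k : nat) := 'rV[K]_#|{: ksub n k}|.

Section Exterior.

Variables (K : fieldType) (n : nat).

Definition supp k (s : 'I_#|{: ksub n k}|) : {set 'I_n} := val (enum_val s).

(* Equal to 0 when A does not have k elements. *)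
Definition ebasis k (A : {set 'I_n}) : ext K n k := \row_s (supp s == A)%:R.
Definition ecoord k (x : ext K n k) (A : {set 'I_n}) : K :=
  \sum_(s | supp s == A) x 0 s.

Definition inversions (A B : {set 'I_n}) : nat :=
  #|[set p : 'I_n * 'I_n | [&& p.1 \in A, p.2 \in B & (p.2 < p.1)%N]]|.

(* The bilinear extension of e_A /\ e_B = (-1)^inversions(A, B) e_(A :|: B) for
   disjoint A, B, and 0 otherwise: a (k + l)-element set C equal to A :|: B
   with #|A| = k and #|B| = l forces A and B to be disjoint. *)
Definition wedge k l (x : ext K n k) (y : ext K n l) : ext K n (k + l) :=
  \row_c \sum_a \sum_(b | supp a :|: supp b == supp c)
     (-1) ^+ inversions (supp a) (supp b) * x 0 a * y 0 b.

Definition ext1 (v : 'cV[K]_n) : ext K n 1 :=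
  \sum_(i < n) v i 0 *: ebasis 1 [set i].

Fixpoint wedgev k : ('I_k -> 'cV[K]_n) -> ext K n k :=
  match k with
  | 0 => fun _ => ebasis 0 set0
  | k'.+1 => fun v =>
      wedge (ext1 (v ord0)) (wedgev (fun i => v (lift ord0 i)))
  end.

(* The i-th smallest element of a k-element set. *)
Definition kelt k (A : ksub n k) (i : 'I_k) : 'I_n :=
  enum_val (cast_ord (esym (eqP (valP A))) i).

(* The natural action of a matrix g on /\^k K^n, the linear map sending
   e_{a_1} /\ ... /\ e_{a_k} to (g e_{a_1}) /\ ... /\ (g e_{a_k}). *)
Definition extmap k (g : 'M[K]_n) (x : ext K n k) : ext K n k :=
  \sum_s x 0 s *: wedgev (fun i => col (kelt (enum_val s) i) g).

(* The identification /\^n K^n = K given by e_1 /\ ... /\ e_n. *)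
Definition vol (x : ext K n n) : K := ecoord x setT.

End Exterior.

Section Projective.

Variables (K : fieldType) (N : nat).

Definition proj := {L : {vspace 'rV[K]_N} | \dim L == 1%N}.

Definition peval (Q : {mpoly K[N]}) (v : 'rV[K]_N) : K := Q.@[fun i => v 0 i].

Definition vanishes_at (Q : {mpoly K[N]}) (p : proj) : Prop :=
  forall v, v \in val p -> peval Q v = 0.

Definition vanishes_on (Q : {mpoly K[N]}) (X : proj -> Prop) : Prop :=
  forall p, X p -> vanishes_at Q p.

Definition zariski_closure (X : proj -> Prop) (p : proj) : Prop :=
  forall (d : nat) (Q : {mpoly K[N]}),
    Q \is d.-homog -> vanishes_on Q X -> vanishes_at Q p.

Definition secant_variety (r : nat) (X : proj -> Prop) : proj -> Prop :=
  zariski_closure (fun p : proj =>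
    exists q : 'I_r -> proj,
      (forall i, X (q i)) /\ (val p <= \sum_(i < r) val (q i))%VS).

(* X is the hypersurface P = 0, and P is its equation in the sense of algebraic
   geometry: it generates the ideal of X. *)
Definition hypersurface_with_equation (X : proj -> Prop) (P : {mpoly K[N]}) :
    Prop :=
  [/\ P != 0,
      exists2 d : nat, (0 < d)%N & P \is d.-homog,
      forall p, X p <-> vanishes_at P p
    & forall Q, vanishes_on Q X <-> exists S, Q = S * P].

End Projective.

(* The Pluecker image of the Grassmannian of k-dimensional linear subspaces U
   of K^n (so the projective notation Gr(2,6) is k = 3, n = 7). *)
Definition grassmannian (K : fieldType) (n k : nat)
    (p : proj K #|{: ksub n k}|) : Prop :=
  exists (U : {vspace 'cV[K]_n}) (u : k.-tuple 'cV[K]_n),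
    [/\ \dim U = k, basis_of U u & val p = <[wedgev (tnth u)]>%VS].

Definition phi (K : fieldType) (w : ext K 7 3) (v : ext K 7 2) : ext K 7 5 :=
  wedge v w.

(* The Gram matrix, in the basis (e_i /\ e_j)_{i < j}, of the bilinear form
   (v, v') |-> v /\ phi_w(v'). *)
Definition phi_gram (K : fieldType) (w : ext K 7 3) :
    'M[K]_#|{: ksub 7 2}| :=
  \matrix_(a, b)
    vol (wedge (ebasis K 2 (supp a)) (phi w (ebasis K 2 (supp b)))).

(* Main.v *)
Require Import Defs.
From HB Require Import structures.
From mathcomp Require Import all_boot all_order all_algebra.
From mathcomp Require Import mpoly complex reals.
From mathcomp Require Import perm spectral ssrAC ring zify.

Set Implicit Arguments.
Unset Strict Implicit.
Unset Printing Implicit Defensive.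

Import Order.TTheory GRing.Theory Num.Theory.
Local Open Scope ring_scope.

(** Let the cone be the set of sums of three decomposable 3-forms, that is, the
   affine cone over the union of the planes spanned by three points of the
   Grassmannian.  The theorem says that the ideal of the cone is generated by
   one polynomial, and that its cube is det phi up to a factor.

   Multiplicity.  A decomposable u /\ v /\ z contributes at most 6 to the rank
   of the Gram matrix (phi_gram_decomposable_rank), so the rank is at most 18
   on the cone and the determinant, of size 21, vanishes there to order three
   (det_phi_cone_dvd).

   A direction and a base line.  Restrict everything to lines y + X p0, where
   p0 is the Fano form, the sum of e_i /\ e_(i+1) /\ e_(i+3) over i mod 7.
   Since det phi is not 0 at p0 (det_phi_fano), it becomes a polynomial of
   degree 21 in X, monic up to a constant.  Give the seven lines of the Fano
   plane the coefficients 0, ..., 6: this is the base form, and on the base line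
   through it the point X = -i is a Fano form with one line missing.  Such a
   form is a sum of three decomposables (cone_fano): it is a net of 2-forms on a
   4-space, whose isotropic members form a conic, and three points of the conic
   span the net.  So the base line meets the cone in seven distinct points, and
   it does so transversally: the tangent space of the GL7-orbit at such a point,
   together with p0, is the whole space (tangent_full).

   Deformation.  By transversality Newton iteration moves the seven points
   along any line through the base form, to any order in the parameter t
   (newton_curve).  If a polynomial B(y, X) vanishes whenever y + X p0 is in
   the cone, restrict it to y = base form + t v and divide by the highest
   possible power of t: the quotient still has the seven roots at t = 0
   (vanish_cone_root).  Hence B = 0 as soon as its degree in X is at most 6
   (vanish_cone_deg6).

   The cube root.  Let f be the monic polynomial of degree 21 in X given by
   det phi, and p its approximate cube root: p is monic of degree 7 and
   r = f - p^3 has degree less than 14.  As f, f', f'' vanish on the cone, so do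
   G = p f' - 3 p' f = p r' - 3 p' r and G'.  This forces double roots of r
   at the seven points, hence r = 0 and f = p^3 (phi_char_cube).  The polynomial
   P7 is p at X = 0, scaled (ex_equation).

   The ideal.  If Q vanishes on the cone, its division along X by p leaves a
   remainder of degree at most 6 that vanishes on the cone, so P7 divides Q
   (equation_dvd).  In particular the closed set P7 = 0 is the closure of the
   cone (equation_hypersurface).

   Invariance.  The cone is stable under GL7, so P7 divides its own transform
   by g and P7(g w) = c(g) P7(w), with c a polynomial character of GL7.  Such a
   character factors through the determinant (character_det) and is trivial
   on SL7. *)

(** * The exterior algebra in coordinates *)

Section ExteriorAlgebra.

Variables (K : fieldType) (n : nat).
Implicit Types (k : nat) (A B C : {set 'I_n}).

Lemma supp_inj k : injective (@supp n k).
Proof. by move=> s t /val_inj/enum_val_inj. Qed.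

Lemma card_supp k (s : 'I_#|{: ksub n k}|) : #|supp s| = k.
Proof. exact/eqP/(valP (enum_val s)). Qed.

Lemma supp_surj k A : #|A| = k -> exists s : 'I_#|{: ksub n k}|, supp s = A.
Proof.
move=> /eqP Ak; exists (enum_rank (exist _ A Ak : ksub n k)).
by rewrite /supp enum_rankK.
Qed.

Lemma sum_supp (M : nmodType) k (f : {set 'I_n} -> M) :
  \sum_(s : 'I_#|{: ksub n k}|) f (supp s) = \sum_(A : {set 'I_n} | #|A| == k) f A.
Proof.
have [A0 /eqP A0k|noA] := pickP (fun A : {set 'I_n} => #|A| == k); last first.
  rewrite [RHS]big_pred0 // big1 // => s _.
  by have := noA (supp s); rewrite card_supp eqxx.
have [s0 _] := supp_surj A0k.
pose h A := odflt s0 [pick s : 'I_#|{: ksub n k}| | supp s == A].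
rewrite (reindex_onto (@supp n k) h) => [|A /eqP Ak].
  apply: eq_big => [s|//]; rewrite card_supp eqxx /h.
  case: pickP => [t /eqP/supp_inj -> /=|/(_ s)]; first by rewrite eqxx.
  by rewrite eqxx.
have [s sA] := supp_surj Ak.
by rewrite /h; case: pickP => [t /eqP //|/(_ s)]; rewrite sA eqxx.
Qed.

Lemma ecoord_supp k (x : ext K n k) s : ecoord x (supp s) = x 0 s.
Proof.
rewrite /ecoord (big_pred1 s) // => t /=; apply/eqP/eqP => [/supp_inj//|->//].
Qed.

Lemma ecoord_card k (x : ext K n k) A : #|A| != k -> ecoord x A = 0.
Proof.
move=> /eqP Ak; rewrite /ecoord big_pred0 // => s.
by apply/eqP => sA; apply: Ak; rewrite -sA card_supp.
Qed.

Lemma ext_eq k (x y : ext K n k) :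
  (forall A, #|A| = k -> ecoord x A = ecoord y A) -> x = y.
Proof.
move=> xy; apply/rowP => s.
by rewrite -!ecoord_supp; apply: xy; rewrite card_supp.
Qed.

Lemma ecoordD k (x y : ext K n k) A : ecoord (x + y) A = ecoord x A + ecoord y A.
Proof. by rewrite /ecoord -big_split; apply: eq_bigr => s _; rewrite mxE. Qed.

Lemma ecoordZ k a (x : ext K n k) A : ecoord (a *: x) A = a * ecoord x A.
Proof. by rewrite /ecoord mulr_sumr; apply: eq_bigr => s _; rewrite mxE. Qed.

Lemma ecoord0 k A : ecoord (0 : ext K n k) A = 0.
Proof. by rewrite /ecoord big1 // => s _; rewrite mxE. Qed.

Lemma ecoordN k (x : ext K n k) A : ecoord (- x) A = - ecoord x A.
Proof. by rewrite -scaleN1r ecoordZ mulN1r. Qed.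

Lemma ecoord_sum k I (r : seq I) (P : pred I) (x : I -> ext K n k) A :
  ecoord (\sum_(i <- r | P i) x i) A = \sum_(i <- r | P i) ecoord (x i) A.
Proof.
by elim/big_rec2: _ => [|i a y _ <-]; rewrite ?ecoord0 ?ecoordD.
Qed.

Lemma ecoord_ebasis k A B :
  #|A| = k -> ecoord (ebasis K k A : ext K n k) B = (B == A)%:R.
Proof.
move=> Ak; have [/eqP Bk|Bk] := boolP (#|B| == k).
  by have [s <-] := supp_surj Bk; rewrite ecoord_supp mxE.
rewrite ecoord_card //; case: eqP => // BA; move: Bk.
by rewrite BA Ak eqxx.
Qed.

Lemma ext_ebasis k (x : ext K n k) : x = \sum_s x 0 s *: ebasis K k (supp s).
Proof.
apply/rowP => t; rewrite summxE (bigD1 t) //= !mxE eqxx mulr1 big1 ?addr0 // => s st.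
by rewrite !mxE (inj_eq (@supp_inj k)) eq_sym (negPf st) mulr0.
Qed.

Lemma wedgeDl k l (x x' : ext K n k) (y : ext K n l) :
  wedge (x + x') y = wedge x y + wedge x' y.
Proof.
apply/rowP => c; rewrite !mxE -big_split; apply: eq_bigr => a _ /=.
by rewrite -big_split; apply: eq_bigr => b _; rewrite mxE mulrDr mulrDl.
Qed.

Lemma wedgeZl k l t (x : ext K n k) (y : ext K n l) :
  wedge (t *: x) y = t *: wedge x y.
Proof.
apply/rowP => c; rewrite !mxE mulr_sumr; apply: eq_bigr => a _ /=.
by rewrite mulr_sumr; apply: eq_bigr => b _; rewrite mxE mulrCA !mulrA.
Qed.

Lemma wedgeDr k l (x : ext K n k) (y y' : ext K n l) :
  wedge x (y + y') = wedge x y + wedge x y'.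
Proof.
apply/rowP => c; rewrite !mxE -big_split; apply: eq_bigr => a _ /=.
by rewrite -big_split; apply: eq_bigr => b _; rewrite mxE mulrDr.
Qed.

Lemma wedgeZr k l t (x : ext K n k) (y : ext K n l) :
  wedge x (t *: y) = t *: wedge x y.
Proof.
apply/rowP => c; rewrite !mxE mulr_sumr; apply: eq_bigr => a _ /=.
by rewrite mulr_sumr; apply: eq_bigr => b _; rewrite mxE mulrCA.
Qed.

Lemma wedge0r k l (x : ext K n k) : wedge x (0 : ext K n l) = 0.
Proof. by rewrite -(scale0r 0) wedgeZr scale0r. Qed.

(** Left multiplication of a form by a vector.  The whole exterior calculus
   below is done with these operators, which anticommute. *)
Definition lmulv k (v : 'cV[K]_n) (y : ext K n k) : ext K n k.+1 :=
  wedge (ext1 v) y.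

Lemma ext1D u v : ext1 (u + v) = ext1 u + ext1 v :> ext K n 1.
Proof. by rewrite -big_split; apply: eq_bigr => i _; rewrite mxE scalerDl. Qed.

Lemma ext1Z a v : ext1 (a *: v) = a *: ext1 v :> ext K n 1.
Proof. by rewrite scaler_sumr; apply: eq_bigr => i _; rewrite mxE scalerA. Qed.

Lemma lmulvDl k u v (y : ext K n k) : lmulv (u + v) y = lmulv u y + lmulv v y.
Proof. by rewrite /lmulv ext1D wedgeDl. Qed.

Lemma lmulvZl k a v (y : ext K n k) : lmulv (a *: v) y = a *: lmulv v y.
Proof. by rewrite /lmulv ext1Z wedgeZl. Qed.

Lemma lmulvDr k u (x y : ext K n k) : lmulv u (x + y) = lmulv u x + lmulv u y.
Proof. exact: (@wedgeDr 1 k). Qed.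

Lemma lmulvZr k a v (y : ext K n k) : lmulv v (a *: y) = a *: lmulv v y.
Proof. exact: (@wedgeZr 1 k). Qed.

Lemma lmulv0r k v : lmulv v (0 : ext K n k) = 0.
Proof. exact: (@wedge0r 1 k). Qed.

Lemma lmulvNr k v (y : ext K n k) : lmulv v (- y) = - lmulv v y.
Proof. by rewrite -scaleN1r lmulvZr scaleN1r. Qed.

Lemma lmulv0l k (y : ext K n k) : lmulv 0 y = 0.
Proof. by rewrite -(scale0r 0) lmulvZl scale0r. Qed.

Lemma lmulv_suml k I (r : seq I) (P : pred I) (v : I -> 'cV[K]_n) (y : ext K n k) :
  lmulv (\sum_(i <- r | P i) v i) y = \sum_(i <- r | P i) lmulv (v i) y.
Proof. by elim/big_rec2: _ => [|i a z _ <-]; rewrite ?lmulv0l ?lmulvDl. Qed.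

Lemma lmulv_sumr k I (r : seq I) (P : pred I) v (y : I -> ext K n k) :
  lmulv v (\sum_(i <- r | P i) y i) = \sum_(i <- r | P i) lmulv v (y i).
Proof. by elim/big_rec2: _ => [|i a z _ <-]; rewrite ?lmulv0r ?lmulvDr. Qed.

Lemma wedge_coord k l (x : ext K n k) (y : ext K n l) C : #|C| = (k + l)%N ->
  ecoord (wedge x y) C =
  \sum_(A : {set 'I_n} | (A \subset C) && (#|A| == k))
     (-1) ^+ inversions A (C :\: A) * ecoord x A * ecoord y (C :\: A).
Proof.
move=> Ckl; have [c cC] := supp_surj Ckl; rewrite -cC ecoord_supp mxE.
under eq_bigr => a _.
  rewrite (_ : \sum_(b | _) _ = (supp a \subset supp c)%:R *
     ((-1) ^+ inversions (supp a) (supp c :\: supp a) * ecoord x (supp a) *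
      ecoord y (supp c :\: supp a))); first over.
  have [/subsetP ac|nac] := boolP (supp a \subset supp c); last first.
    rewrite mul0r big_pred0 // => b; apply: contraNF nac => /eqP <-.
    exact: subsetUl.
  rewrite mul1r.
  have dl : #|supp c :\: supp a| = l.
    rewrite cardsD (setIidPr _) ?card_supp ?cC ?Ckl ?addKn //.
    by rewrite -cC; apply/subsetP.
  have [d dE] := supp_surj dl; rewrite -dE.
  rewrite (big_pred1 d) ?ecoord_supp // => b; rewrite /= -(inj_eq (@supp_inj l)) dE.
  apply/eqP/eqP => [E|->]; last by rewrite setDE setUIr setUCr setIT; apply/setUidPr/subsetP.
  apply/eqP; rewrite eq_sym eqEcard dl card_supp leqnn andbT -E setDUl setDv set0U.
  exact: subsetDl.
rewrite (sum_supp k (fun A => (A \subset supp c)%:R * ((-1) ^+ inversions A (supp c :\: A) *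
   ecoord x A * ecoord y (supp c :\: A)))) [RHS]big_mkcondl.
by apply: eq_bigr => A _; case: ifP; rewrite (mul1r, mul0r).
Qed.

Lemma ecoord_ext1 (v : 'cV[K]_n) A : ecoord (ext1 v) A = \sum_(i < n) v i 0 * (A == [set i])%:R.
Proof.
rewrite ecoord_sum; apply: eq_bigr => i _.
by rewrite ecoordZ ecoord_ebasis ?cards1.
Qed.

(** The exponent of the sign of e_i /\ e_(A - i) = +- e_A. *)
Definition below (i : 'I_n) A := #|[set j in A | (j < i)%N]|.

Lemma inversions1 i A : inversions [set i] A = below i A.
Proof.
rewrite /inversions /below.
have pair_inj : injective (fun j : 'I_n => (i, j)) by move=> j l [].
rewrite -[RHS](card_imset _ pair_inj).
apply: eq_card => -[p q]; rewrite inE /= inE; apply/and3P/imsetP => [[/eqP-> qA qi]|].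
  by exists q; rewrite // inE qA.
by case=> j; rewrite inE => /andP[jA ji] [-> ->]; rewrite eqxx.
Qed.

Lemma below_setD1 i j A : below i (A :\ j) = (below i A - ((j \in A) && (j < i)%N))%N.
Proof.
rewrite /below [in RHS](cardsD1 j) inE addKn; apply: eq_card => l.
by rewrite !inE andbA.
Qed.

Lemma lmulv_coord k v (y : ext K n k) C :
  ecoord (lmulv v y) C =
  \sum_(i in C) (-1) ^+ below i C * v i 0 * ecoord y (C :\ i).
Proof.
have [/eqP Ck|Ck] := boolP (#|C| == k.+1); last first.
  rewrite ecoord_card // big1 // => i iC; rewrite [ecoord y _]ecoord_card ?mulr0 //.
  by apply: contraNN Ck => /eqP <-; rewrite (cardsD1 i) iC.
rewrite (@wedge_coord 1 k) //.
under eq_bigr => A _ do rewrite ecoord_ext1 -mulrA mulr_suml mulr_sumr.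
rewrite exchange_big /= [RHS]big_mkcond /=; apply: eq_bigr => i _.
case: ifP => iC; last first.
  rewrite big1 // => A /andP[AC _]; case: eqP => [E|_]; rewrite ?mulr0 ?mul0r ?mulr0 //.
  by move: AC; rewrite E sub1set iC.
rewrite (bigD1 [set i]) /= ?sub1set ?iC ?cards1 //= eqxx mulr1 inversions1 mulrA.
rewrite below_setD1 ltnn andbF subn0 big1 ?addr0 // => A /andP[_ /negPf->].
by rewrite mulr0 mul0r mulr0.
Qed.

(** The coordinates of both sides are sums over ordered pairs i, j of elements of
   A.  Removing the smaller element first lowers by one the number of elements
   below the larger one; removing the larger first changes nothing.  So the two
   orders of removal have opposite signs. *)
Lemma lmulv_anti k u v (y : ext K n k) : lmulv u (lmulv v y) = - lmulv v (lmulv u y).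
Proof.
apply: ext_eq => A _; rewrite ecoordN !lmulv_coord.
under eq_bigr => i iA do rewrite lmulv_coord mulr_sumr.
under [in RHS]eq_bigr => i iA do rewrite lmulv_coord mulr_sumr.
pose f (i j : 'I_n) := (i \in A) && (j \in A) && (i != j).
transitivity (\sum_(i < n) \sum_(j < n | f i j) (-1) ^+ below i A * u i 0 *
  ((-1) ^+ below j (A :\ i) * v j 0 * ecoord y (A :\ i :\ j))).
  rewrite [LHS]big_mkcond; apply: eq_bigr => i _.
  case: ifP => iA; last by rewrite big_pred0 // => j; rewrite /f iA.
  by apply: eq_bigl => j; rewrite /f iA !inE eq_sym andbC.
transitivity (- (\sum_(j < n) \sum_(i < n | f j i) (-1) ^+ below j A * v j 0 *
  ((-1) ^+ below i (A :\ j) * u i 0 * ecoord y (A :\ j :\ i)))); last first.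
  congr (- _); rewrite [RHS]big_mkcond; apply: eq_bigr => i _.
  case: ifP => iA; last by rewrite big_pred0 // => j; rewrite /f iA.
  by apply: eq_bigl => j; rewrite /f iA !inE eq_sym andbC.
rewrite (exchange_big_dep predT) //= -sumrN; apply: eq_bigr => j _.
rewrite -sumrN; apply: eq_big => [i|i]; first by rewrite /f /= [(i \in A) && _]andbC [i == j]eq_sym.
case/andP=> /andP[iA jA] ij.
have -> : A :\ j :\ i = A :\ i :\ j by apply/setP => l; rewrite !inE andbCA.
rewrite !below_setD1 iA jA /=.
have bp (p q : 'I_n) : p \in A -> (p < q)%N -> (0 < below q A)%N.
  by move=> pA pq; rewrite /below (cardsD1 p) inE pA pq.
have [lij|lji|/val_inj E] := ltngtP i j; last by rewrite E eqxx in ij.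
- rewrite subn0; have := bp _ _ iA lij; case: (below j A) => // b _.
  rewrite subn1 /= exprS; move: ((-1) ^+ _) ((-1) ^+ _) (ecoord _ _) => s t x; ring.
- rewrite subn0; have := bp _ _ jA lji; case: (below i A) => // b _.
  rewrite subn1 /= exprS; move: ((-1) ^+ _) ((-1) ^+ _) (ecoord _ _) => s t x; ring.
Qed.

End ExteriorAlgebra.

(** * Decomposable 3-vectors *)

Section Multivectors.

Variables (K : numClosedFieldType) (n : nat).
Implicit Types (k : nat) (A B C : {set 'I_n}) (u v z : 'cV[K]_n).

Lemma lmulvv k v (y : ext K n k) : lmulv v (lmulv v y) = 0.
Proof.
have /eqP := lmulv_anti v v y; rewrite -subr_eq0 opprK -mulr2n -scaler_nat.
by rewrite scaler_eq0 pnatr_eq0 => /eqP.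
Qed.

Definition evec (i : 'I_n) : 'cV[K]_n := delta_mx i 0.

Lemma cV_evec v : v = \sum_i v i 0 *: evec i.
Proof.
apply/colP => j; rewrite summxE (bigD1 j) //= !mxE !eqxx mulr1 big1 ?addr0 //.
by move=> i ij; rewrite !mxE eq_sym (negPf ij) mulr0.
Qed.

Lemma lmulv_evec_coord k i (y : ext K n k) C :
  ecoord (lmulv (evec i) y) C =
  (i \in C)%:R * (-1) ^+ below i C * ecoord y (C :\ i).
Proof.
rewrite lmulv_coord; have [iC|iC] := boolP (i \in C).
  rewrite (bigD1 i iC) /= mxE !eqxx mulr1 mul1r big1 ?addr0 // => j /andP[_ ji].
  by rewrite mxE (negPf ji) mulr0 mul0r.
rewrite !mul0r big1 // => j jC; rewrite mxE; case: eqP => [ji|]; last by rewrite mulr0 mul0r.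
by move: iC; rewrite -ji jC.
Qed.

Lemma below_eq0 (i : 'I_n) A : (forall j, j \in A -> (i <= j)%N) -> below i A = 0%N.
Proof.
move=> iA; apply/eqP; rewrite cards_eq0; apply/eqP/setP => j; rewrite !inE.
by apply/negP => /andP[/iA ij]; rewrite ltnNge ij.
Qed.

Lemma lmulv_ebasis k (i : 'I_n) A : #|A| = k -> (forall j, j \in A -> (i < j)%N) ->
  lmulv (evec i) (ebasis K k A) = ebasis K k.+1 (i |: A).
Proof.
move=> Ak iA; have iNA : i \notin A by apply/negP => /iA; rewrite ltnn.
apply: ext_eq => C _; rewrite lmulv_evec_coord !ecoord_ebasis ?cardsU1 ?iNA ?Ak //.
have [iC|iNC] := boolP (i \in C); last first.
  rewrite !mul0r; case: eqP => // CE; move: iNC.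
  by rewrite CE setU11.
have [->|CA] := eqVneq C (i |: A).
  rewrite setU1K // eqxx below_eq0 ?mulr1 // => j; rewrite !inE => /predU1P[->//|/iA/ltnW//].
case: eqP => [E|_]; last by rewrite mulr0.
by move: CA; rewrite -E setD1K // eqxx.
Qed.

(** The sign bookkeeping needs to be done only once, for the two-element basis
   forms: multiplication by e_i /\ e_j is the composite of two vector
   multiplications. *)
Lemma wedge_ebasis2 k (i j : 'I_n) (y : ext K n k) : (i < j)%N ->
  wedge (ebasis K 2 [set i; j]) y = lmulv (evec i) (lmulv (evec j) y).
Proof.
move=> ij; have ne_ij : i != j by rewrite -val_eqE neq_ltn ij.
have ij2 : #|[set i; j]| = 2 by rewrite cards2 ne_ij.
apply: ext_eq => C Ck; rewrite (@wedge_coord _ _ 2 k) // !lmulv_evec_coord.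
under eq_bigr => A _ do rewrite ecoord_ebasis // -mulrA mulrCA.
have [iC|iC] := boolP (i \in C); last first.
  rewrite !mul0r big1 // => A /andP[/subsetP AC _].
  case: eqP => [E|]; last by rewrite mul0r.
  by have := AC i; rewrite E !inE eqxx (negPf iC) => /(_ isT).
have [jC|jC] := boolP (j \in C); last first.
  rewrite inE (negPf jC) andbF !mul0r mulr0 big1 // => A /andP[/subsetP AC _].
  case: eqP => [E|]; last by rewrite mul0r.
  by have := AC j; rewrite E !inE eqxx (negPf jC) orbT => /(_ isT).
rewrite (bigD1 [set i; j]) /=; last first.
  by rewrite ij2 eqxx andbT subUset !sub1set iC jC.
rewrite big1 ?addr0; last by move=> A /andP[_ /negPf->]; rewrite mul0r.
rewrite eqxx !mul1r !inE eq_sym ne_ij jC mul1r mulrA -exprD setDDl; congr (_ ^+ _ * _).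
set D := C :\: [set i; j].
have -> : inversions [set i; j] D = (below i D + below j D)%N.
  rewrite /inversions -!inversions1 /inversions.
  rewrite -cardsUI [X in (_ + X)%N](_ : _ = 0%N) ?addn0.
    by apply: eq_card => -[p q]; rewrite !inE /= andb_orl.
  apply/eqP; rewrite cards_eq0; apply/eqP/setP => -[p q]; rewrite !inE /=.
  by apply/negP => /andP[/and3P[/eqP-> _ _] /and3P[/eqP E _ _]]; move: ne_ij; rewrite E eqxx.
have ji : (j < i)%N = false by rewrite ltnNge ltnW.
by rewrite /D -setDDl !below_setD1 !inE iC jC ij ji /= !ltnn !andbF /= !subn0.
Qed.

Definition wedge3 u v z : ext K n 3 :=
  lmulv u (lmulv v (lmulv z (ebasis K 0 set0))).

Lemma wedgev3 (t : 'I_3 -> 'cV[K]_n) : wedgev t = wedge3 (t ord0) (t 1) (t ord_max).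
Proof.
have E0 : lift ord0 (ord0 : 'I_2) = 1 by apply/val_inj.
have E1 : lift ord0 (lift ord0 (ord0 : 'I_1)) = ord_max :> 'I_3 by apply/val_inj.
by rewrite -E0 -E1.
Qed.

(** Over an arbitrary ring, because the coordinates of u /\ v /\ z are needed
   both for vectors over K and for vectors of polynomials. *)
Definition det3 (R : comPzRingType) (u v z : 'I_n -> R) (a b c : 'I_n) : R :=
  u a * (v b * z c - v c * z b) - u b * (v a * z c - v c * z a)
  + u c * (v a * z b - v b * z a).

Definition vcoord v : 'I_n -> K := fun i => v i 0.

Lemma ord_ltF (p q : 'I_n) : (p < q)%N -> (p == q = false) * (q == p = false).
Proof. by move=> pq; split; apply/negP => /eqP E; move: pq; rewrite E ltnn. Qed.

Lemma set3_card (a b c : 'I_n) : (a < b < c)%N -> #|[set a; b; c]| = 3.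
Proof.
case/andP=> ab bc; have ac := ltn_trans ab bc.
by rewrite -setUA cardsU1 cards2 !inE !(ord_ltF ab, ord_ltF bc, ord_ltF ac).
Qed.

Lemma wedge3_coord u v z (a b c : 'I_n) : (a < b < c)%N ->
  ecoord (wedge3 u v z) [set a; b; c] = det3 (vcoord u) (vcoord v) (vcoord z) a b c.
Proof.
case/andP=> ab bc; have ac := ltn_trans ab bc.
have big3 (f : 'I_n -> K) : \sum_(i in [set a; b; c]) f i = f a + f b + f c.
  by rewrite -setUA big_setU1 ?big_setU1 ?big_set1 ?inE ?(ord_ltF ab) ?(ord_ltF ac)
     ?(ord_ltF bc) //= addrA.
have big2 (p q : 'I_n) (f : 'I_n -> K) : (p < q)%N ->
    \sum_(i in [set p; q]) f i = f p + f q.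
  by move=> pq; rewrite big_setU1 ?big_set1 // inE (ord_ltF pq).
have D1 : [set a; b; c] :\ a = [set b; c].
  apply/setP => i; rewrite !inE; case: eqP => [->|//]; by rewrite (ord_ltF ab) (ord_ltF ac).
have D2 : [set a; b; c] :\ b = [set a; c].
  apply/setP => i; rewrite !inE; case: (eqVneq i b) => [->|//]; rewrite ?(ord_ltF ab) ?(ord_ltF bc) ?orbF //.
have D3 : [set a; b; c] :\ c = [set a; b].
  apply/setP => i; rewrite !inE; case: (eqVneq i c) => [->|//]; rewrite ?(ord_ltF ac) ?(ord_ltF bc) ?orbF //.
have E1 (p q : 'I_n) : (p < q)%N -> [set p; q] :\ p = [set q].
  move=> pq; apply/setP => i; rewrite !inE; case: (eqVneq i p) => [->|//].
  by rewrite (ord_ltF pq).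
have E2 (p q : 'I_n) : (p < q)%N -> [set p; q] :\ q = [set p].
  move=> pq; apply/setP => i; rewrite !inE; case: (eqVneq i q) => [->|//]; rewrite ?orbF //.
  by rewrite (ord_ltF pq).
have B1 (p q : 'I_n) : (p < q)%N -> below p [set p; q] = 0%N.
  move=> pq; apply: below_eq0 => j; rewrite !inE => /orP[] /eqP -> //; exact: ltnW.
have B2 (p q : 'I_n) : (p < q)%N -> below q [set p; q] = 1%N.
  move=> pq; rewrite /below -(cards1 p); apply: eq_card => j; rewrite !inE.
  by case: (eqVneq j p) => [->|_] /=; rewrite ?pq //; case: eqP => // ->; rewrite ltnn.
have C1 : below a [set a; b; c] = 0%N.
  apply: below_eq0 => j; rewrite !inE -orbA => /or3P[] /eqP -> //; exact: ltnW.
have C2 : below b [set a; b; c] = 1%N.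
  rewrite /below -(cards1 a); apply: eq_card => j; rewrite !inE.
  case: (eqVneq j a) => [->|_] /=; rewrite ?ab //; case: eqP => [->|_] /=; rewrite ?ltnn //.
  by case: eqP => // ->; rewrite ltnNge ltnW.
have C3 : below c [set a; b; c] = 2.
  transitivity #|[set a; b]|; last by rewrite cards2 (ord_ltF ab).
  rewrite /below; apply: eq_card => j; rewrite !inE.
  case: (eqVneq j a) => [->|_] /=; rewrite ?ac //; case: (eqVneq j b) => [->|_] /=; rewrite ?bc //.
  by case: eqP => // ->; rewrite ltnn.
have one (x : 'cV[K]_n) (p : 'I_n) : ecoord (lmulv x (ebasis K 0 set0)) [set p] = x p 0.
  rewrite lmulv_coord big_set1 setDv ecoord_ebasis ?cards0 // eqxx mulr1.
  by rewrite below_eq0 ?mul1r // => j; rewrite inE => /eqP ->.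
have two (x y : 'cV[K]_n) (p q : 'I_n) : (p < q)%N ->
    ecoord (lmulv x (lmulv y (ebasis K 0 set0))) [set p; q] = x p 0 * y q 0 - x q 0 * y p 0.
  move=> pq; rewrite lmulv_coord big2 // B1 // B2 // E1 // E2 // !one; ring.
rewrite lmulv_coord big3 C1 C2 C3 D1 D2 D3 !two // /det3 /vcoord.
by move: (u a 0) (u b 0) (u c 0) => *; ring.
Qed.

End Multivectors.

(** * The action of matrices on 3-vectors *)

Section Functoriality.

Variables (K : numClosedFieldType) (n : nat).
Implicit Types (k : nat) (A B C : {set 'I_n}) (u v z : 'cV[K]_n) (g h : 'M[K]_n).

Lemma sorted_enum_set A : sorted (fun i j : 'I_n => (i < j)%N) (enum A).
Proof.
rewrite /enum_mem sorted_filter //; first by move=> i j l; apply: ltn_trans.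
by have := iota_ltn_sorted 0 n; rewrite -val_enum_ord sorted_map enumT.
Qed.

Lemma enum_sorted_set (s : seq 'I_n) :
  sorted (fun i j : 'I_n => (i < j)%N) s -> enum [set i in s] = s.
Proof.
move=> s_sorted; apply: (irr_sorted_eq _ _ (sorted_enum_set _) s_sorted).
- by move=> i j l; apply: ltn_trans.
- by move=> i; apply: ltnn.
- by move=> i; rewrite mem_enum inE.
Qed.

Lemma enum_set2 (a b : 'I_n) : (a < b)%N -> enum [set a; b] = [:: a; b].
Proof.
move=> ab; have ss : sorted (fun i j : 'I_n => (i < j)%N) [:: a; b] by rewrite /= ab.
by rewrite -[RHS](enum_sorted_set ss); apply: eq_enum => i; rewrite !inE.
Qed.

Lemma enum_set3 (a b c : 'I_n) : (a < b < c)%N -> enum [set a; b; c] = [:: a; b; c].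
Proof.
move=> abc; have ss : sorted (fun i j : 'I_n => (i < j)%N) [:: a; b; c].
  by case/andP: abc => /= -> ->.
by rewrite -[RHS](enum_sorted_set ss); apply: eq_enum => i; rewrite !inE orbA.
Qed.

Lemma set2_sorted A : #|A| = 2 -> exists a b : 'I_n, (a < b)%N /\ A = [set a; b].
Proof.
have := sorted_enum_set A; have EA i : (i \in A) = (i \in enum A) by rewrite mem_enum.
move: EA; rewrite cardE; case: (enum A) => [|a [|b []]] //= EA /andP[ab _] _.
by exists a, b; split=> //; apply/setP => i; rewrite EA !inE.
Qed.

Lemma set3_sorted A : #|A| = 3 ->
  exists a b c : 'I_n, (a < b < c)%N /\ A = [set a; b; c].
Proof.
have := sorted_enum_set A; have EA i : (i \in A) = (i \in enum A) by rewrite mem_enum.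
move: EA; rewrite cardE; case: (enum A) => [|a [|b [|c []]]] //= EA /and3P[ab bc _] _.
by exists a, b, c; split; rewrite ?ab //; apply/setP => i; rewrite EA !inE orbA.
Qed.

Lemma ext3_eq (x y : ext K n 3) :
  (forall a b c : 'I_n, (a < b < c)%N -> ecoord x [set a; b; c] = ecoord y [set a; b; c]) ->
  x = y.
Proof. by move=> xy; apply: ext_eq => A /set3_sorted[a [b [c [abc ->]]]]; apply: xy. Qed.

Lemma wedge3Dl u u' v z : wedge3 (u + u') v z = wedge3 u v z + wedge3 u' v z.
Proof. exact: lmulvDl. Qed.

Lemma wedge3Zl a u v z : wedge3 (a *: u) v z = a *: wedge3 u v z.
Proof. exact: lmulvZl. Qed.

Lemma wedge3C12 u v z : wedge3 v u z = - wedge3 u v z.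
Proof. exact: lmulv_anti. Qed.

Lemma wedge3C23 u v z : wedge3 u z v = - wedge3 u v z.
Proof. by rewrite /wedge3 (lmulv_anti z v) lmulvNr. Qed.

Lemma wedge3_eq12 u z : wedge3 u u z = 0.
Proof. exact: lmulvv. Qed.

Lemma wedge3_eq23 u v : wedge3 u v v = 0.
Proof. by rewrite /wedge3 lmulvv lmulv0r. Qed.

Lemma wedge3_sums I J L (r : seq I) (s : seq J) (t : seq L)
    (u : I -> 'cV[K]_n) (v : J -> 'cV[K]_n) (z : L -> 'cV[K]_n) :
  wedge3 (\sum_(i <- r) u i) (\sum_(j <- s) v j) (\sum_(l <- t) z l) =
  \sum_(i <- r) \sum_(j <- s) \sum_(l <- t) wedge3 (u i) (v j) (z l).
Proof.
rewrite /wedge3 lmulv_suml; apply: eq_bigr => i _.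
rewrite lmulv_suml lmulv_sumr; apply: eq_bigr => j _.
by rewrite lmulv_suml !lmulv_sumr.
Qed.

Lemma extmapD k g (x y : ext K n k) : extmap g (x + y) = extmap g x + extmap g y.
Proof. by rewrite -big_split; apply: eq_bigr => s _; rewrite mxE scalerDl. Qed.

Lemma extmapZ k g a (x : ext K n k) : extmap g (a *: x) = a *: extmap g x.
Proof. by rewrite scaler_sumr; apply: eq_bigr => s _; rewrite mxE scalerA. Qed.

Lemma extmap0 k g : extmap g (0 : ext K n k) = 0.
Proof. by have := extmapZ g 0 (0 : ext K n k); rewrite !scale0r. Qed.

Lemma extmapN k g (x : ext K n k) : extmap g (- x) = - extmap g x.
Proof. by rewrite -scaleN1r extmapZ scaleN1r. Qed.

Lemma extmap_sum k g I (r : seq I) (P : pred I) (x : I -> ext K n k) :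
  extmap g (\sum_(i <- r | P i) x i) = \sum_(i <- r | P i) extmap g (x i).
Proof. by elim/big_rec2: _ => [|i a y _ <-]; rewrite ?extmap0 ?extmapD. Qed.

Lemma wedge3_evec (a b c : 'I_n) : (a < b < c)%N ->
  wedge3 (evec K a) (evec K b) (evec K c) = ebasis K 3 [set a; b; c].
Proof.
case/andP=> ab bc; have ac := ltn_trans ab bc.
rewrite /wedge3 !lmulv_ebasis ?setU0 ?setUA ?cards0 ?cards1 ?cards2 ?(ord_ltF bc) //.
- by move=> j; rewrite !inE => /orP[] /eqP ->.
- by move=> j; rewrite inE => /eqP ->.
- by move=> j; rewrite inE.
Qed.

Lemma extmap_ebasis3 g (a b c : 'I_n) : (a < b < c)%N ->
  extmap g (ebasis K 3 [set a; b; c]) = wedge3 (col a g) (col b g) (col c g).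
Proof.
move=> abc; have [s sE] := supp_surj (set3_card abc).
rewrite /extmap (bigD1 s) //= mxE sE eqxx scale1r big1 ?addr0; last first.
  move=> t ts; rewrite mxE -sE (inj_eq (@supp_inj _ _)) (negPf ts) scale0r //.
have enumE : enum (val (enum_val s)) = [:: a; b; c].
  by rewrite -[val _]/(supp s) sE enum_set3.
have keltE i : kelt (enum_val s) i = nth a [:: a; b; c] i.
  rewrite /kelt /enum_val (set_nth_default a) -?enumE //.
  by rewrite -cardE; apply: ltn_ord.
by rewrite -[LHS]/(wedgev (fun i => col (kelt (enum_val s) i) g)) wedgev3 !keltE.
Qed.

Lemma col_mulevec g i : col i g = g *m evec K i.
Proof. by rewrite colE. Qed.

(** Both sides are alternating in i, j, l, so it is enough to sort the indices:
   on increasing triples this is the definition of the action. *)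
Lemma extmap_wedge3_evec g i j l :
  extmap g (wedge3 (evec K i) (evec K j) (evec K l)) =
  wedge3 (col i g) (col j g) (col l g).
Proof.
pose T i j l := extmap g (wedge3 (evec K i) (evec K j) (evec K l)) ==
  wedge3 (col i g) (col j g) (col l g).
have T12 a b c : T a b c = T b a c.
  by rewrite /T [wedge3 (evec K b) _ _]wedge3C12 [wedge3 (col b g) _ _]wedge3C12 extmapN eqr_opp.
have T23 a b c : T a b c = T a c b.
  by rewrite /T [wedge3 _ (evec K c) _]wedge3C23 [wedge3 _ (col c g) _]wedge3C23 extmapN eqr_opp.
have T1 a c : T a a c by rewrite /T !wedge3_eq12 extmap0.
have T2 a c : T a c c by rewrite /T !wedge3_eq23 extmap0.
have T0 (a b c : 'I_n) : (a < b)%N -> (b < c)%N -> T a b c.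
  by move=> ab bc; rewrite /T wedge3_evec ?extmap_ebasis3 ?ab.
apply/eqP; rewrite -[_ == _]/(T i j l).
have [ij|ji|/val_inj->] := ltngtP i j; last exact: T1.
- have [jl|lj|/val_inj->] := ltngtP j l; [exact: T0| |exact: T2].
  rewrite T23; have [il|li|/val_inj->] := ltngtP i l; [exact: T0| |exact: T1].
  by rewrite T12; apply: T0.
- rewrite T12; have [il|li|/val_inj->] := ltngtP i l; [exact: T0| |exact: T2].
  rewrite T23; have [jl|lj|/val_inj->] := ltngtP j l; [exact: T0| |exact: T1].
  by rewrite T12; apply: T0.
Qed.

Lemma extmap_wedge3 g u v z :
  extmap g (wedge3 u v z) = wedge3 (g *m u) (g *m v) (g *m z).
Proof.
have gE x : g *m x = \sum_i x i 0 *: col i g.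
  by rewrite {1}[x]cV_evec mulmx_sumr; apply: eq_bigr => i _; rewrite -scalemxAr -colE.
rewrite !gE {1}[u]cV_evec {1}[v]cV_evec {1}[z]cV_evec !wedge3_sums extmap_sum.
apply: eq_bigr => i _; rewrite extmap_sum; apply: eq_bigr => j _.
rewrite extmap_sum; apply: eq_bigr => l _.
by rewrite /wedge3 !(lmulvZl, lmulvZr) -!/(wedge3 _ _ _) !extmapZ extmap_wedge3_evec.
Qed.

Lemma extmapM3 g h (w : ext K n 3) : extmap (g *m h) w = extmap g (extmap h w).
Proof.
rewrite [w]ext_ebasis (extmap_sum h) (extmap_sum g) (extmap_sum (g *m h)).
apply: eq_bigr => s _; rewrite (extmapZ h) (extmapZ g) (extmapZ (g *m h)); congr (_ *: _).
have [a [b [c [abc ->]]]] := set3_sorted (card_supp s).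
by rewrite -wedge3_evec // (extmap_wedge3 h) (extmap_wedge3 g) extmap_wedge3 !mulmxA.
Qed.

Lemma extmap1 (w : ext K n 3) : extmap 1%:M w = w.
Proof.
rewrite [w in LHS]ext_ebasis [RHS]ext_ebasis !extmap_sum; apply: eq_bigr => s _.
have [a [b [c [abc ->]]]] := set3_sorted (card_supp s).
by rewrite !extmapZ -wedge3_evec // !extmap_wedge3 !mul1mx.
Qed.

End Functoriality.

(** * The rank of the form phi at a decomposable *)

Lemma mxrank_sum_le (F : fieldType) m n I (r : seq I) (P : pred I) (M : I -> 'M[F]_(m, n)) :
  (\rank (\sum_(i <- r | P i) M i)%R <= \sum_(i <- r | P i) \rank (M i))%N.
Proof.
elim/big_rec2: _ => [|i s N _ IH]; first by rewrite mxrank0.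
by apply: leq_trans (mxrank_add _ _) _; rewrite leq_add2l.
Qed.

(** In bases adapted to S, the rows of the pencil beyond the rank of S come from T
   alone, so each of them is divisible by 'X. *)
Lemma det_pencil_dvd (F : fieldType) m r (S T : 'M[F]_m) : (\rank S + r <= m)%N ->
  'X^r %| \det (map_mx polyC S + 'X *: map_mx polyC T).
Proof.
move=> Sr; set k := \rank S in Sr.
pose L := col_ebase S; pose U := row_ebase S.
have Lu : L \in unitmx := col_ebase_unit S.
have Uu : U \in unitmx := row_ebase_unit S.
have SE : S = L *m pid_mx k *m U by rewrite mulmx_ebase.
have [N TE] : exists N, T = L *m N *m U.
  by exists (invmx L *m T *m invmx U); rewrite !mulmxA mulmxV // mul1mx mulmxKV.
pose d : 'rV[{poly F}]_m := \row_i 'X^(k <= i).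
pose M := \matrix_(i, j) (if (i < k)%N then (pid_mx k i j : F)%:P + 'X * (N i j)%:P
                          else (N i j)%:P).
have -> : map_mx polyC S + 'X *: map_mx polyC T =
    map_mx polyC L *m (diag_mx d *m M) *m map_mx polyC U.
  rewrite {1}SE {1}TE !map_mxM scalemxAl scalemxAr -mulmxDl -mulmxDr.
  congr (_ *m _ *m _); apply/matrixP => i j; rewrite mul_diag_mx !mxE.
  case: leqP => ik /=; last by rewrite mul1r.
  by rewrite andbF add0r expr1.
rewrite !det_mulmx det_diag dvdp_mulr // dvdp_mull // dvdp_mulr //.
under eq_bigr => i _ do rewrite mxE.
rewrite -expr_sum; apply: dvdp_exp2l.
suff : (m <= k + \sum_(i < m) (k <= i))%N.
  by move=> mk; rewrite -(leq_add2l k); apply: leq_trans Sr mk.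
elim: (m) => [//|p IH]; rewrite big_ord_recr /= addnA.
have [kp|kp] := leqP k p; first by rewrite addn1 ltnS.
by rewrite addn0; apply: leq_trans kp _; rewrite leq_addr.
Qed.

Section RankOfPhi.

Variable K : numClosedFieldType.
Implicit Types (u v z x y : 'cV[K]_7) (w : ext K 7 3) (g : 'M[K]_7).

(** The bilinear form of w on decomposable 2-vectors, as a quadrilinear form. *)
Definition vol4 u v x y w : K := vol (lmulv u (lmulv v (lmulv x (lmulv y w)))).

Lemma phi_gramE w s t (i j k l : 'I_7) : (i < j)%N -> (k < l)%N ->
  supp s = [set i; j] -> supp t = [set k; l] ->
  phi_gram w s t = vol4 (evec K i) (evec K j) (evec K k) (evec K l) w.
Proof.
move=> ij kl sE tE; rewrite mxE /phi sE tE (@wedge_ebasis2 K 7 3) //.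
by rewrite (@wedge_ebasis2 K 7 5).
Qed.

Lemma phi_gramD w w' : phi_gram (w + w') = phi_gram w + phi_gram w'.
Proof. by apply/matrixP => s t; rewrite !mxE /phi !wedgeDr /vol ecoordD. Qed.

Lemma phi_gramZ a w : phi_gram (a *: w) = a *: phi_gram w.
Proof. by apply/matrixP => s t; rewrite !mxE /phi !wedgeZr /vol ecoordZ. Qed.

Lemma vol4_suml I (r : seq I) (P : pred I) (f : I -> 'cV[K]_7) v x y w :
  vol4 (\sum_(i <- r | P i) f i) v x y w = \sum_(i <- r | P i) vol4 (f i) v x y w.
Proof. by rewrite /vol4 lmulv_suml /vol ecoord_sum. Qed.

Lemma vol4_sum2 I (r : seq I) (P : pred I) (f : I -> 'cV[K]_7) u x y w :
  vol4 u (\sum_(i <- r | P i) f i) x y w = \sum_(i <- r | P i) vol4 u (f i) x y w.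
Proof. by rewrite /vol4 lmulv_suml lmulv_sumr /vol ecoord_sum. Qed.

Lemma vol4Z1 a u v x y w : vol4 (a *: u) v x y w = a * vol4 u v x y w.
Proof. by rewrite /vol4 lmulvZl /vol ecoordZ. Qed.

Lemma vol4Z2 a u v x y w : vol4 u (a *: v) x y w = a * vol4 u v x y w.
Proof. by rewrite /vol4 lmulvZl lmulvZr /vol ecoordZ. Qed.

Lemma vol4C12 u v x y w : vol4 v u x y w = - vol4 u v x y w.
Proof. by rewrite /vol4 lmulv_anti /vol ecoordN. Qed.

Lemma vol4_eq12 u x y w : vol4 u u x y w = 0.
Proof. by rewrite /vol4 lmulvv /vol ecoord0. Qed.

Lemma vol4_annihilate u v x y w : lmulv v w = 0 -> vol4 u v x y w = 0.
Proof.
move=> vw; rewrite /vol4 (lmulv_anti v) (lmulv_anti v y) vw.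
by rewrite lmulv0r oppr0 lmulv0r oppr0 lmulv0r /vol ecoord0.
Qed.

(** Gaussian elimination on the 3 x 7 matrix with rows u, v, z puts the three
   vectors in the span of the first three columns of an invertible g, where the
   third exterior power is one-dimensional. *)
Lemma wedge3_std u v z : exists2 g : 'M[K]_7, g \in unitmx &
  exists c, wedge3 u v z = c *: wedge3 (col 0 g) (col 1 g) (col 2%:R g).
Proof.
pose t := [tuple u; v; z].
pose M : 'M[K]_(3, 7) := \matrix_(i, j) (tnth t i) j 0.
pose N := col_ebase M *m pid_mx (\rank M) : 'M_(3, 7).
pose g := (row_ebase M)^T.
have ME : M = N *m g^T by rewrite trmxK mulmx_ebase.
exists g; first by rewrite unitmx_tr row_ebase_unit.
pose b i := (row i N)^T.
have tE i : tnth t i = g *m b i.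
  by rewrite -[g]trmxK -trmx_mul -row_mul -ME; apply/colP => j; rewrite !mxE.
have b0 i (j : 'I_7) : (2 < j)%N -> b i j 0 = 0.
  move=> j2; rewrite !mxE big1 // => l _; rewrite !mxE.
  rewrite (_ : (l == j :> nat) = false) ?mulr0 //.
  by apply/negP => /eqP E; move: j2; rewrite -E; have := ltn_ord l; lia.
pose c := det3 (vcoord (b 0)) (vcoord (b 1)) (vcoord (b ord_max)) 0 1 2%:R.
exists c; rewrite !col_mulevec -extmap_wedge3 -extmapZ.
rewrite -[u]/(tnth t 0) -[v]/(tnth t 1) -[z]/(tnth t ord_max) !tE -extmap_wedge3.
congr extmap; apply: ext3_eq => i j l ijl.
rewrite ecoordZ !wedge3_coord //.
have [l2|l2] := leqP l 2.
  have [-> -> ->] : [/\ i = 0, j = 1 & l = 2%:R].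
    by case/andP: ijl => ij jl; split; apply/val_inj => /=; lia.
  rewrite -/c -[LHS]mulr1; congr (_ * _).
  by rewrite /det3 /vcoord !mxE /=; ring.
have bl k : vcoord (b k) l = 0 by apply: b0.
have el (m : 'I_7) : (m <= 2)%N -> vcoord (evec K m) l = 0.
  move=> m2; rewrite /vcoord mxE; case: eqP => // E.
  by move: m2; rewrite -E leqNgt l2.
by rewrite /det3 !bl !el //; ring.
Qed.

(** Only the pairs of basis vectors outside the 3-space of u, v, z contribute:
   in a basis that begins with a basis of this 3-space, that is 'C(4, 2) = 6
   pairs. *)
Lemma phi_gram_decomposable_rank u v z : (\rank (phi_gram (wedge3 u v z)) <= 6)%N.
Proof.
have [g gu [c ->]] := wedge3_std u v z; rewrite phi_gramZ.
apply: leq_trans (mxrank_scale _ _) _.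
set w := wedge3 _ _ _; pose h := invmx g.
have annih (i : 'I_7) : (i < 3)%N -> lmulv (col i g) w = 0.
  move=> i3; have : i \in [:: 0; 1; 2%:R] by case: i i3 => [[|[|[|]]]].
  rewrite !inE => /or3P[] /eqP ->.
  - exact: lmulvv.
  - by rewrite /w /wedge3 lmulv_anti lmulvv lmulv0r oppr0.
  - by rewrite /w /wedge3 lmulv_anti (lmulv_anti (col 2%:R g)) lmulvv !(lmulv0r, oppr0).
have evecE i : evec K i = \sum_c h c i *: col c g.
  rewrite -[evec K i]mul1mx -(mulmxV gu) -mulmxA -/h -col_mulevec.
  apply/colP => j; rewrite !(mxE, summxE); apply: eq_bigr => l _; rewrite !mxE; ring.
(* In the basis of the columns of g, the Gram matrix is a sum of rank-one
   matrices mn p q *m rw p q, one for each pair p < q of columns; it vanishes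
   when the pair meets the first three columns. *)
pose mn (p q : 'I_7) : 'cV[K]_#|{: ksub 7 2}| :=
  \col_s (if enum (supp s) is [:: i; j] then h p i * h q j - h q i * h p j else 0).
pose rw (p q : 'I_7) : 'rV[K]_#|{: ksub 7 2}| :=
  \row_s (if enum (supp s) is [:: k; l] then
     vol4 (col p g) (col q g) (evec K k) (evec K l) w else 0).
have -> : phi_gram w = \sum_(p < 7 | (2 < p)%N) \sum_(q < 7 | (p < q)%N) mn p q *m rw p q.
  apply/matrixP => s t.
  have [i [j [ij sE]]] := set2_sorted (card_supp s).
  have [k [l [kl tE]]] := set2_sorted (card_supp t).
  rewrite (phi_gramE w ij kl sE tE) summxE.
  under eq_bigr => p _ do rewrite summxE.
  under eq_bigr => p _ do under eq_bigr => q _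
    do rewrite mxE big_ord1 mxE mxE sE tE !enum_set2 //.
  pose V p q := vol4 (col p g) (col q g) (evec K k) (evec K l) w.
  transitivity (\sum_p \sum_q h p i * h q j * V p q).
    rewrite {1}(evecE i) {1}(evecE j) vol4_suml; apply: eq_bigr => p _.
    rewrite vol4_sum2; apply: eq_bigr => q _.
    by rewrite vol4Z2 vol4Z1 mulrA [h q j * _]mulrC.
  have V0 (p q : 'I_7) : (p < 3)%N || (q < 3)%N -> V p q = 0.
    case/orP => [p3|q3]; rewrite /V; last by rewrite vol4_annihilate ?annih.
    by rewrite vol4C12 vol4_annihilate ?annih ?oppr0.
  have VC p q : V q p = - V p q by apply: vol4C12.
  have Vd p : V p p = 0 by apply: vol4_eq12.
  rewrite [RHS]big_mkcond /=.
  transitivity (\sum_(p < 7) \sum_(q < 7) (if (p < q)%N then (h p i * h q j - h q i * h p j) * V p q else 0)).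
    transitivity (\sum_(p < 7) \sum_(q < 7) ((if (p < q)%N then h p i * h q j * V p q else 0)
       + (if (q < p)%N then h p i * h q j * V p q else 0))).
      apply: eq_bigr => p _; apply: eq_bigr => q _.
      by case: (ltngtP p q) => [_|_|/val_inj->]; rewrite ?addr0 ?add0r ?Vd ?mulr0.
    under eq_bigr => p _ do rewrite big_split /=.
    rewrite big_split /= [X in _ + X]exchange_big -big_split /=.
    apply: eq_bigr => p _; rewrite -big_split /=; apply: eq_bigr => q _.
    case: ifP => _; last by rewrite addr0.
    rewrite (VC p q); ring.
  apply: eq_bigr => p _; case: ltnP => p2.
    by rewrite [RHS]big_mkcond.
  rewrite big1 // => q _; case: ifP => // _; rewrite V0 ?mulr0 //.
  by rewrite ltnS p2.
apply: leq_trans (mxrank_sum_le _ _ _) _.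
apply: (@leq_trans (\sum_(p < 7 | (2 < p)%N) \sum_(q < 7 | (p < q)%N) 1)).
  apply: leq_sum => p _; apply: leq_trans (mxrank_sum_le _ _ _) _.
  by apply: leq_sum => q _; apply: mulmx_max_rank.
by under eq_bigr => p _ do rewrite big_mkcond; rewrite big_mkcond !big_ord_recl !big_ord0.
Qed.

End RankOfPhi.

(** * The cone of sums of three decomposables *)

Lemma card_ksub n k : #|{: ksub n k}| = 'C(n, k).
Proof. by rewrite card_sig -[n in RHS]card_ord -card_draws; apply: eq_card => A; rewrite !inE. Qed.

Section Cone.

Variable K : numClosedFieldType.
Implicit Types (u v z x y : 'cV[K]_7) (w : ext K 7 3) (g : 'M[K]_7).

Definition cone w := exists u v z : 'I_3 -> 'cV[K]_7,
  w = \sum_m wedge3 (u m) (v m) (z m).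

Lemma cone3 u v z u' v' z' u'' v'' z'' :
  cone (wedge3 u v z + wedge3 u' v' z' + wedge3 u'' v'' z'').
Proof.
exists (fun m => [:: u; u'; u'']`_m), (fun m => [:: v; v'; v'']`_m), (fun m => [:: z; z'; z'']`_m).
by rewrite !big_ord_recl big_ord0 /= addr0 addrA.
Qed.

Lemma cone_extmap g w : cone w -> cone (extmap g w).
Proof.
case=> [u [v [z ->]]]; exists (fun m => g *m u m), (fun m => g *m v m), (fun m => g *m z m).
by rewrite extmap_sum; apply: eq_bigr => m _; rewrite extmap_wedge3.
Qed.

Lemma phi_gram0 : phi_gram (0 : ext K 7 3) = 0.
Proof. by rewrite -(scale0r 0) phi_gramZ scale0r. Qed.

Lemma phi_gram_sum I (r : seq I) (P : pred I) (f : I -> ext K 7 3) :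
  phi_gram (\sum_(i <- r | P i) f i) = \sum_(i <- r | P i) phi_gram (f i).
Proof. by elim/big_rec2: _ => [|i a b _ <-]; rewrite ?phi_gram0 ?phi_gramD. Qed.

Lemma phi_gram_cone_rank w : cone w -> (\rank (phi_gram w) <= 18)%N.
Proof.
case=> [u [v [z ->]]]; rewrite phi_gram_sum.
apply: leq_trans (mxrank_sum_le _ _ _) _.
apply: (@leq_trans (\sum_(m < 3) 6)); last by rewrite sum_nat_const card_ord.
by apply: leq_sum => m _; apply: phi_gram_decomposable_rank.
Qed.

Lemma det_phi_cone_dvd w w' : cone w ->
  'X^3 %| \det (map_mx polyC (phi_gram w) + 'X *: map_mx polyC (phi_gram w')).
Proof.
move=> cw; apply: det_pencil_dvd.
apply: (@leq_trans (18 + 3)); last by rewrite card_ksub.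
by rewrite leq_add2r phi_gram_cone_rank.
Qed.

(** The 2-forms of the net are combinations of N1 = p ab + cd/p,
   N2 = q ac + bd/q and N3 = r ad + bc/r, with squares 2, -2, 2 times abcd; the
   net is brought to this form by splitting each pair of coefficients as
   al p, al / p.  Then N1 + N2, N1 - N2 and N2 + N3 have square zero, so they
   are decomposable, and they span the net. *)
Lemma cone_net (k1 k2 k3 a b c d : 'cV[K]_7) (y1 y2 y3 y4 y5 y6 : K) :
  y1 != 0 -> y2 != 0 -> y3 != 0 -> y4 != 0 -> y5 != 0 -> y6 != 0 ->
  cone (y1 *: wedge3 k1 a b + y2 *: wedge3 k1 c d
        + y3 *: wedge3 k2 a c + y4 *: wedge3 k2 b d
        + y5 *: wedge3 k3 a d + y6 *: wedge3 k3 b c).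
Proof.
have root_split s t : s != 0 -> t != 0 -> exists r p : K, [/\ p != 0, s = r * p & t = r / p].
  move=> s0 t0; pose r := sqrtC (s * t); have r2 : r ^+ 2 = s * t by rewrite sqrtCK.
  have r0 : r != 0 by rewrite sqrtC_eq0 mulf_neq0.
  exists r, (s / r); split; first by rewrite mulf_neq0 ?invr_eq0.
    by rewrite mulrC divfK.
  by rewrite invf_div mulrA -expr2 r2 mulrAC divff ?mul1r.
move=> n1 n2 n3 n4 n5 n6.
have [al [p [p0 -> ->]]] := root_split _ _ n1 n2.
have [be [q [q0 -> ->]]] := root_split _ _ n3 n4.
have [ga [r [r0 -> ->]]] := root_split _ _ n5 n6.
(* With D+ = N1 + N2, D- = N1 - N2 and D3 = N2 + N3, the form
   al k1 N1 + be k2 N2 + ga k3 N3 is rearranged along D+, D- and D3. *)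
set w := (w in cone w).
have -> : w = wedge3 (2^-1 *: (al *: k1 + be *: k2 - ga *: k3))
                     (a - (p * q)^-1 *: d) (p *: b + q *: c)
            + wedge3 (2^-1 *: (al *: k1 - be *: k2 + ga *: k3))
                     (a + (p * q)^-1 *: d) (p *: b - q *: c)
            + wedge3 (ga *: k3) (a + (q * r)^-1 *: b) (q *: c + r *: d).
  apply: ext3_eq => i j l ijl; rewrite /w !ecoordD !ecoordZ !wedge3_coord //.
  by rewrite /det3 /vcoord !mxE; field; rewrite p0 q0 r0.
exact: cone3.
Qed.

End Cone.

(** * Forms supported on the Fano plane *)

Lemma sum_ord7 (M : nmodType) (f : nat -> M) :
  \sum_(k < 7) f k = f 0%N + f 1%N + f 2%N + f 3%N + f 4%N + f 5%N + f 6%N.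
Proof. by rewrite !big_ord_recr big_ord0 /= add0r. Qed.

Section Fano.

Variable K : numClosedFieldType.

Definition fano_line (i : 'I_7) : ext K 7 3 :=
  wedge3 (evec K i) (evec K (i + 1)) (evec K (i + 3%:R)).

Definition fano (x : 'I_7 -> K) : ext K 7 3 := \sum_i x i *: fano_line i.

Lemma inord7D (a b : nat) : (a < 7)%N -> (b < 7)%N ->
  inord a + inord b = inord ((a + b) %% 7) :> 'I_7.
Proof. by move=> a7 b7; apply/val_inj; rewrite /= !inordK ?ltn_pmod. Qed.

Lemma inord7_nat (a : nat) : (a < 7)%N -> inord a = a%:R :> 'I_7.
Proof.
case: a => [|[|[|[|[|[|[|a]]]]]]] // _; apply/val_inj; by rewrite /= inordK.
Qed.

Lemma addr_inord7_eq (m : 'I_7) k : (k < 7)%N -> (m + inord k == m) = (k == 0%N).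
Proof. by move=> k7; rewrite -subr_eq0 addrC addKr -val_eqE /= inordK. Qed.

(** All lines of the Fano plane are the translates of a single one, so a
   statement about a line m can be moved to line 0 by renumbering the basis. *)
Definition shifted_evec (m : 'I_7) (k : nat) : 'cV[K]_7 := evec K (m + inord k).

Lemma fano_line_shift m (k : 'I_7) : fano_line (m + k) =
  wedge3 (shifted_evec m k) (shifted_evec m ((k + 1) %% 7)%N) (shifted_evec m ((k + 3) %% 7)%N).
Proof.
have shift a : (a < 7)%N -> k + a%:R = inord ((k + a) %% 7) :> 'I_7.
  by move=> a7; rewrite -[k in LHS]inord_val -inord7_nat // inord7D.
have s1 : k + 1 = inord ((k + 1) %% 7) :> 'I_7 by apply: (shift 1%N).
by rewrite /fano_line /shifted_evec inord_val -!addrA s1 (shift 3).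
Qed.

(** The missing line passes through the points 0, 1, 3 relative to m; by the
   axioms of the Fano plane each of the other six lines contains exactly one of
   these points and two of the four points 2, 4, 5, 6, the two lines through the
   same point splitting the four points into disjoint pairs. *)
Lemma cone_fano (x : 'I_7 -> K) m : (forall i, (x i == 0) = (i == m)) -> cone (fano x).
Proof.
move=> xm; set E := shifted_evec m; pose X k := x (m + inord k).
have -> : fano x = \sum_(k < 7) X k *: wedge3 (E k) (E ((k + 1) %% 7)%N) (E ((k + 3) %% 7)%N).
  rewrite /fano (reindex_inj (addrI m)) /=; apply: eq_bigr => k _.
  by rewrite /X inord_val fano_line_shift.
have X0 : X 0%N = 0 by apply/eqP; rewrite /X xm addr_inord7_eq.
have Xn k : (0 < k < 7)%N -> X k != 0.
  by case/andP=> k0 k7; rewrite /X xm addr_inord7_eq // -lt0n.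
have cyc u v z : wedge3 u v z = wedge3 v z u :> ext K 7 3.
  by rewrite wedge3C12 wedge3C23 opprK.
rewrite (_ : \sum_(k < 7) _ =
  X 4%N *: wedge3 (E 0%N) (E 4%N) (E 5%N) + X 6%N *: wedge3 (E 0%N) (E 2%N) (E 6%N)
  + - X 1%N *: wedge3 (E 1%N) (E 4%N) (E 2%N) + X 5%N *: wedge3 (E 1%N) (E 5%N) (E 6%N)
  + X 3%N *: wedge3 (E 3%N) (E 4%N) (E 6%N) + X 2%N *: wedge3 (E 3%N) (E 5%N) (E 2%N)).
  by apply: cone_net; rewrite ?oppr_eq0 Xn.
rewrite (sum_ord7 (fun k => X k *: wedge3 (E k) (E ((k + 1) %% 7)%N) (E ((k + 3) %% 7)%N))).
rewrite X0 scale0r add0r.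
rewrite -[LHS]/(X 1%N *: wedge3 (E 1%N) (E 2%N) (E 4%N) + X 2%N *: wedge3 (E 2%N) (E 3%N) (E 5%N)
  + X 3%N *: wedge3 (E 3%N) (E 4%N) (E 6%N) + X 4%N *: wedge3 (E 4%N) (E 5%N) (E 0%N)
  + X 5%N *: wedge3 (E 5%N) (E 6%N) (E 1%N) + X 6%N *: wedge3 (E 6%N) (E 0%N) (E 2%N)).
rewrite (wedge3C23 (E 1%N) (E 2%N) (E 4%N)) scalerN -scaleNr opprK.
rewrite (cyc (E 0%N) (E 4%N)) (cyc (E 0%N) (E 2%N)) (cyc (E 2%N) (E 6%N)).
rewrite (cyc (E 1%N) (E 5%N)) (cyc (E 3%N) (E 5%N)) (cyc (E 5%N) (E 2%N)).
by rewrite [LHS](ACl (4*6*1*5*3*2)).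
Qed.

End Fano.

(** * Nondegeneracy at the Fano form *)

Definition strike (m : bitseq) (i : nat) : bitseq := set_nth false m i false.

(** Subsets of {0, ..., 6} are represented by bit masks, so that the Gram matrix
   at the Fano form can be computed by evaluation.  The value at l and m is the
   coordinate on e_m of the wedge product of the e_i with i in l: expanding
   along the head i strikes i from m, with the sign of moving i past the smaller
   elements of m. *)
Fixpoint wedge_sign (l : seq nat) (m : bitseq) : int :=
  if l is i :: l' then
    if nth false m i then (-1) ^+ count id (take i m) * wedge_sign l' (strike m i) else 0
  else (~~ has id m)%:R.

Definition fano_entry (p q : nat * nat) : int :=
  foldr (fun a s => wedge_sign [:: p.1; p.2; q.1; q.2; a; (a + 1) %% 7; (a + 3) %% 7]%N
                      (nseq 7 true) + s) 0 (iota 0 7).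

Definition pairs7 : seq (nat * nat) :=
  [seq p <- [seq (i, j) | i <- iota 0 7, j <- iota 0 7] | (p.1 < p.2)%N].

Definition fano_gram : seq (seq int) :=
  Eval vm_compute in [seq [seq fano_entry p q | q <- pairs7] | p <- pairs7].

Definition dotz (r s : seq int) : int := foldr +%R 0 [seq p.1 * p.2 | p <- zip r s].

(** The Gram matrix M at the Fano form is a root of X^3 - 3 X + 2, so 3 - M^2 is
   twice its inverse. *)
Definition fano_gram_inv : seq (seq int) :=
  Eval vm_compute in
    [seq [seq 3 *+ (i == j) - dotz (nth [::] fano_gram i) (nth [::] fano_gram j) | j <- iota 0 21]
       | i <- iota 0 21].

Definition gram_entry (T : seq (seq int)) (i j : nat) : int := nth 0 (nth [::] T i) j.

Section FanoGram.

Variable K : numClosedFieldType.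

Definition maskset (m : bitseq) : {set 'I_7} := [set i : 'I_7 | nth false m i].

Lemma below_maskset (i : 'I_7) m : size m = 7 -> below i (maskset m) = count id (take i m).
Proof.
move=> m7; rewrite /below -sum1_card big_mkcond /=.
have i7 : (i <= 7)%N by apply: ltnW.
rewrite -sum1_count [RHS]big_mkcond (big_nth false) size_takel ?m7 //.
rewrite big_mkord (big_ord_widen 7 (fun j => if nth false (take i m) j then 1%N else 0%N)) //.
rewrite [RHS]big_mkcond; apply: eq_bigr => j _; rewrite !inE.
by case: ltnP => ji; rewrite ?andbF // andbT nth_take.
Qed.

Lemma wedge_sign_step k (i : 'I_7) (y : ext K 7 k) m : size m = 7 ->
  ecoord (lmulv (evec K i) y) (maskset m) =
  (if nth false m i then (-1) ^+ count id (take i m) else 0) * ecoord y (maskset (strike m i)).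
Proof.
move=> m7; rewrite lmulv_evec_coord below_maskset // inE; case: ifP => mi; last by rewrite !mul0r.
rewrite mul1r; congr (_ * ecoord _ _); apply/setP => j; rewrite !inE /strike nth_set_nth /=.
by rewrite val_eqE; case: eqP.
Qed.

Lemma ecoord_ebasis0 m : size m = 7 -> ecoord (ebasis K 0 set0 : ext K 7 0) (maskset m) = (~~ has id m)%:R.
Proof.
move=> m7; rewrite ecoord_ebasis ?cards0 //.
suff -> : (maskset m == set0) = ~~ has id m by [].
apply/idP/idP => [/eqP E|/hasPn m0].
  apply/hasPn => b /(nthP false) => -[j]; rewrite m7 => i7 <-.
  by have := in_set0 (Ordinal i7); rewrite -E inE => ->.
apply/eqP/setP => i; rewrite !inE; apply/negP => mi.
have im : (i < size m)%N by rewrite m7.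
by have := m0 _ (mem_nth false im); rewrite mi.
Qed.

Lemma vol4_wedge_sign (i j k l a b c : 'I_7) :
  vol4 (evec K i) (evec K j) (evec K k) (evec K l) (wedge3 (evec K a) (evec K b) (evec K c))
  = (wedge_sign [:: (i : nat); (j : nat); (k : nat); (l : nat); (a : nat); (b : nat); (c : nat)]
       (nseq 7 true))%:~R.
Proof.
have -> : vol4 (evec K i) (evec K j) (evec K k) (evec K l) (wedge3 (evec K a) (evec K b) (evec K c)) =
   ecoord (lmulv (evec K i) (lmulv (evec K j) (lmulv (evec K k) (lmulv (evec K l)
     (wedge3 (evec K a) (evec K b) (evec K c)))))) (maskset (nseq 7 true)).
  rewrite /vol4 /vol; congr ecoord; apply/setP => x; rewrite !inE.
  by rewrite nth_nseq ltn_ord.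
have sz m x : size m = 7 -> (x < 7)%N -> size (strike m x) = 7.
  by move=> m7 x7; rewrite size_set_nth m7; apply/maxn_idPr.
have step p (y : ext K 7 p) (x : 'I_7) l' m : size m = 7 ->
    ecoord y (maskset (strike m x)) = (wedge_sign l' (strike m x))%:~R ->
    ecoord (lmulv (evec K x) y) (maskset m) = (wedge_sign ((x : nat) :: l') m)%:~R.
  move=> m7 IH; rewrite wedge_sign_step //= IH; case: ifP => _; last by rewrite mul0r.
  by rewrite intrM rmorphXn rmorphN1.
do 7! (apply: (step); first by do ?apply: (sz)).
rewrite /= ecoord_ebasis0 //; first by case: has.
by do ?apply: (sz).
Qed.

Definition fano_form : ext K 7 3 := fano (fun _ => 1).

Definition pair_of (s : 'I_#|{: ksub 7 2}|) : nat * nat :=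
  if enum (supp s) is [:: i; j] then (val i, val j) else (0, 0)%N.

Lemma pair_ofP s : exists i j : 'I_7,
  [/\ (i < j)%N, supp s = [set i; j] & pair_of s = (val i, val j)].
Proof.
have [i [j [ij sE]]] := set2_sorted (card_supp s).
by exists i, j; rewrite /pair_of sE enum_set2.
Qed.

Lemma phi_gram_fano s t : phi_gram fano_form s t = (fano_entry (pair_of s) (pair_of t))%:~R.
Proof.
have [i [j [ij sE ->]]] := pair_ofP s; have [k [l [kl tE ->]]] := pair_ofP t.
rewrite (phi_gramE _ ij kl sE tE).
have vol4_sum5 f : vol4 (evec K i) (evec K j) (evec K k) (evec K l) (\sum_(a < 7) f a) =
    \sum_(a < 7) vol4 (evec K i) (evec K j) (evec K k) (evec K l) (f a).
  by rewrite /vol4 !lmulv_sumr /vol ecoord_sum.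
rewrite /fano_form /fano vol4_sum5.
have foldr7 (f : nat -> int) : foldr (fun a s => f a + s) 0 (iota 0 7) = \sum_(a < 7) f a.
  by rewrite sum_ord7 /= addr0 !addrA.
rewrite /fano_entry foldr7 rmorph_sum; apply: eq_bigr => a _.
by rewrite scale1r vol4_wedge_sign.
Qed.

Definition pair_index s : nat := index (pair_of s) pairs7.

Lemma pair_of_inj : injective pair_of.
Proof.
move=> s t; have [i [j [ij sE ->]]] := pair_ofP s; have [k [l [kl tE ->]]] := pair_ofP t.
by case=> /val_inj ik /val_inj jl; apply: (@supp_inj 7 2); rewrite sE tE ik jl.
Qed.

Lemma pair_of_mem s : pair_of s \in pairs7.
Proof.
have [i [j [ij _ ->]]] := pair_ofP s; rewrite mem_filter; apply/andP; split=> //.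
apply/allpairsP; exists (val i, val j).
by split; rewrite // mem_iota; apply: ltn_ord.
Qed.

Lemma pair_index_mem s : pair_index s \in iota 0 21.
Proof. by rewrite mem_iota -[(0 + 21)%N]/(size pairs7) index_mem pair_of_mem. Qed.

Lemma pair_index_inj : injective pair_index.
Proof.
move=> s t /(congr1 (nth (0, 0)%N pairs7)); rewrite !nth_index ?pair_of_mem //.
exact: pair_of_inj.
Qed.

Lemma sum_pair_index (M : nmodType) (f : nat -> M) :
  \sum_s f (pair_index s) = \sum_(k <- iota 0 21) f k.
Proof.
have um : uniq (map pair_index (enum 'I_#|{: ksub 7 2}|)) by rewrite (map_inj_uniq pair_index_inj) enum_uniq.
have sub : {subset map pair_index (enum 'I_#|{: ksub 7 2}|) <= iota 0 21}.
  by move=> k /mapP[s _ ->]; apply: pair_index_mem.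
have sz : (size (iota 0 21) <= size (map pair_index (enum 'I_#|{: ksub 7 2}|)))%N.
  by rewrite size_map size_iota -cardE card_ord card_ksub.
have [_ eqm] := uniq_min_size um sub sz.
rewrite -big_enum -(big_map pair_index xpredT f); apply: perm_big.
by apply: uniq_perm; rewrite ?iota_uniq.
Qed.

Lemma fano_gramE s t :
  phi_gram fano_form s t = (gram_entry fano_gram (pair_index s) (pair_index t))%:~R.
Proof.
rewrite phi_gram_fano; congr (_%:~R).
have -> : fano_gram = [seq [seq fano_entry p q | q <- pairs7] | p <- pairs7] by vm_compute.
rewrite /gram_entry (nth_map (0, 0)%N) ?index_mem ?pair_of_mem //.
by rewrite (nth_map (0, 0)%N) ?index_mem ?pair_of_mem // !nth_index ?pair_of_mem.
Qed.

(** The identity M (3 - M^2) = 2 between the two integer tables is checked by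
   evaluation, then read in K, where 2 is invertible. *)
Lemma det_phi_fano : \det (phi_gram fano_form) != 0.
Proof.
pose N : 'M[K]_#|{: ksub 7 2}| :=
  \matrix_(s, t) (gram_entry fano_gram_inv (pair_index s) (pair_index t))%:~R.
have MN : phi_gram fano_form *m N = 2%:M.
  apply/matrixP => s t; rewrite !mxE.
  transitivity ((\sum_u gram_entry fano_gram (pair_index s) (pair_index u) *
      gram_entry fano_gram_inv (pair_index u) (pair_index t))%:~R : K).
    by rewrite rmorph_sum; apply: eq_bigr => u _; rewrite fano_gramE mxE -intrM.
  rewrite (sum_pair_index (fun k => gram_entry fano_gram (pair_index s) k *
      gram_entry fano_gram_inv k (pair_index t))).
  have chk : all (fun i => all (fun j =>
      foldr +%R 0 [seq gram_entry fano_gram i k * gram_entry fano_gram_inv k j | k <- iota 0 21]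
       == 2 *+ (i == j)) (iota 0 21)) (iota 0 21) by vm_compute.
  have /eqP := allP (allP chk _ (pair_index_mem s)) _ (pair_index_mem t).
  by rewrite foldrE big_map => ->; rewrite rmorphMn rmorph_nat (inj_eq pair_index_inj).
apply/negP => /eqP d0; have := congr1 determinant MN.
rewrite det_mulmx d0 mul0r det_scalar => /esym/eqP.
by rewrite expf_eq0 pnatr_eq0 andbF.
Qed.

End FanoGram.

(** * The conormal space of the orbit of a punctured Fano form *)

Section TangentSpace.

Variable K : numClosedFieldType.

(** The determinant of this cyclic system is a1 a2 a3 + b1 b2 b3. *)
Lemma three_cycle (a1 a2 a3 b1 b2 b3 t1 t2 t3 : K) :
  a1 * t1 + b1 * t2 = 0 -> a2 * t2 + b2 * t3 = 0 -> a3 * t3 + b3 * t1 = 0 ->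
  a1 * a2 * a3 = b1 * b2 * b3 -> a1 * a2 * a3 != 0 -> [/\ t1 = 0, t2 = 0 & t3 = 0].
Proof.
move=> E1 E2 E3 ab a0.
have kill t : 2 * (a1 * a2 * a3) * t = 0 -> t = 0.
  by move/eqP; rewrite mulf_eq0 [2 * _ == 0]mulf_eq0 pnatr_eq0 (negPf a0) => /eqP.
have two : 2 * (a1 * a2 * a3) = a1 * a2 * a3 + b1 * b2 * b3 by rewrite -ab; ring.
split; apply: kill; rewrite two.
- have -> : (a1 * a2 * a3 + b1 * b2 * b3) * t1 = a2 * a3 * (a1 * t1 + b1 * t2)
    - b1 * a3 * (a2 * t2 + b2 * t3) + b1 * b2 * (a3 * t3 + b3 * t1) by ring.
  by rewrite E1 E2 E3; ring.
- have -> : (a1 * a2 * a3 + b1 * b2 * b3) * t2 = a1 * a3 * (a2 * t2 + b2 * t3)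
    - b2 * a1 * (a3 * t3 + b3 * t1) + b2 * b3 * (a1 * t1 + b1 * t2) by ring.
  by rewrite E1 E2 E3; ring.
- have -> : (a1 * a2 * a3 + b1 * b2 * b3) * t3 = a1 * a2 * (a3 * t3 + b3 * t1)
    - b3 * a2 * (a1 * t1 + b1 * t2) + b3 * b1 * (a2 * t2 + b2 * t3) by ring.
  by rewrite E1 E2 E3; ring.
Qed.

(** Here t i j k is the value on e_i /\ e_j /\ e_k of a linear functional on
   3-forms.  The hypotheses are the alternating rules, the vanishing of the
   functional on the image of the Fano form, with line 0 removed, under the
   infinitesimal matrix that sends e_b to e_a, for all a and b, and its vanishing
   on the full Fano form. *)
Section Conormal.

Variables (t : nat -> nat -> nat -> K) (X : nat -> K).
Arguments t (_ _ _)%_N.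
Arguments X _%_N.
Hypotheses (s213 : forall i j k, t j i k = - t i j k) (s132 : forall i j k, t i k j = - t i j k).
Hypotheses (d12 : forall i k, t i i k = 0) (X0 : X 0 = 0).
Hypothesis Xn : forall k, (0 < k < 7)%N -> X k != 0.
Hypothesis eqs : forall a b, (a < 7)%N -> (b < 7)%N ->
  X b * t a ((b + 1) %% 7) ((b + 3) %% 7)
  + X ((b + 6) %% 7) * t ((b + 6) %% 7) a ((b + 2) %% 7)
  + X ((b + 4) %% 7) * t ((b + 4) %% 7) ((b + 5) %% 7) a = 0.
Hypothesis eq0 : t 0 1 3 + t 1 2 4 + t 2 3 5 + t 3 4 6 + t 4 5 0 + t 5 6 1 + t 6 0 2 = 0.

(** For a and b distinct the line through both drops out of the equation, which
   has at most two terms.  Among the 28 triples that are not lines, the four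
   disjoint from line 0 occur alone in some equation, and each of the others
   lies in a cyclic system of three equations.  For a = b the equation
   says that the values on the three lines through the point b, with
   their coefficients X, add up to zero.  The sum over all points shows that the
   six weighted values add up to zero, since a line has three points; the sum
   over the points of one line then isolates twice the value on this line, as
   two lines always meet in one point.  Line 0 itself is reached only by the
   last hypothesis. *)
Lemma fano_conormal0 (i j k : nat) : (i < j)%N -> (j < k)%N -> (k < 7)%N -> t i j k = 0.
Proof.
have s231 a b c : t b c a = t a b c by rewrite s132 s213 opprK.
have s312 a b c : t c a b = t a b c by rewrite s213 s132 opprK.
have s321 a b c : t c b a = - t a b c by rewrite s213 s231.
have d23 a b : t a b b = 0 by rewrite -s231 d12.
have d13 a b : t a b a = 0 by rewrite s132 d12 oppr0.
have z245 : t 2 4 5 = 0.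
  have E : X 1 * t 2 4 5 = 0.
    have <- : X 1 * t 5 2 4 + X 0 * t 0 5 3 + X 5 * t 5 6 5 = 0 := @eqs 5%N 1%N isT isT.
    by rewrite (s312 2 4 5) d13 X0; ring.
  by apply/eqP; move/eqP: E; rewrite mulf_eq0 ?oppr_eq0 (negPf (@Xn 1%N isT)).
have z256 : t 2 5 6 = 0.
  have E : (- X 2) * t 2 5 6 = 0.
    have <- : X 3 * t 6 4 6 + X 2 * t 2 6 5 + X 0 * t 0 1 6 = 0 := @eqs 6%N 3%N isT isT.
    by rewrite d13 (s132 2 5 6) X0; ring.
  by apply/eqP; move/eqP: E; rewrite mulf_eq0 ?oppr_eq0 (negPf (@Xn 2%N isT)).
have z246 : t 2 4 6 = 0.
  have E : X 1 * t 2 4 6 = 0.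
    have <- : X 1 * t 6 2 4 + X 0 * t 0 6 3 + X 5 * t 5 6 6 = 0 := @eqs 6%N 1%N isT isT.
    by rewrite (s312 2 4 6) d23 X0; ring.
  by apply/eqP; move/eqP: E; rewrite mulf_eq0 ?oppr_eq0 (negPf (@Xn 1%N isT)).
have z456 : t 4 5 6 = 0.
  have E : X 4 * t 4 5 6 = 0.
    have <- : X 0 * t 6 1 3 + X 6 * t 6 6 2 + X 4 * t 4 5 6 = 0 := @eqs 6%N 0%N isT isT.
    by rewrite d12 X0; ring.
  by apply/eqP; move/eqP: E; rewrite mulf_eq0 ?oppr_eq0 (negPf (@Xn 4%N isT)).
have [z012 z036 z134] : [/\ t 0 1 2 = 0, t 0 3 6 = 0 & t 1 3 4 = 0].
  have E1 : X 1 * t 0 1 2 + (- X 3) * t 0 3 6 = 0.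
    have <- : X 4 * t 0 5 0 + X 3 * t 3 0 6 + X 1 * t 1 2 0 = 0 := @eqs 0%N 4%N isT isT.
    by rewrite d13 (s213 0 3 6) (s231 0 1 2); ring.
  have E2 : X 6 * t 0 3 6 + X 1 * t 1 3 4 = 0.
    have <- : X 2 * t 3 3 5 + X 1 * t 1 3 4 + X 6 * t 6 0 3 = 0 := @eqs 3%N 2%N isT isT.
    by rewrite d12 (s312 0 3 6); ring.
  have E3 : X 3 * t 1 3 4 + (- X 6) * t 0 1 2 = 0.
    have <- : X 6 * t 1 0 2 + X 5 * t 5 1 1 + X 3 * t 3 4 1 = 0 := @eqs 1%N 6%N isT isT.
    by rewrite (s213 0 1 2) d23 (s231 1 3 4); ring.
  apply: (three_cycle E1 E2 E3); rewrite ?mulf_neq0 ?oppr_eq0 ?Xn //; ring.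
have [z014 z035 z123] : [/\ t 0 1 4 = 0, t 0 3 5 = 0 & t 1 2 3 = 0].
  have E1 : (- X 1) * t 0 1 4 + X 2 * t 0 3 5 = 0.
    have <- : X 2 * t 0 3 5 + X 1 * t 1 0 4 + X 6 * t 6 0 0 = 0 := @eqs 0%N 2%N isT isT.
    by rewrite (s213 0 1 4) d23; ring.
  have E2 : X 4 * t 0 3 5 + X 1 * t 1 2 3 = 0.
    have <- : X 4 * t 3 5 0 + X 3 * t 3 3 6 + X 1 * t 1 2 3 = 0 := @eqs 3%N 4%N isT isT.
    by rewrite (s231 0 3 5) d12; ring.
  have E3 : X 2 * t 1 2 3 + (- X 4) * t 0 1 4 = 0.
    have <- : X 5 * t 1 6 1 + X 4 * t 4 1 0 + X 2 * t 2 3 1 = 0 := @eqs 1%N 5%N isT isT.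
    by rewrite d13 (s321 0 1 4) (s231 1 2 3); ring.
  apply: (three_cycle E1 E2 E3); rewrite ?mulf_neq0 ?oppr_eq0 ?Xn //; ring.
have [z015 z034 z136] : [/\ t 0 1 5 = 0, t 0 3 4 = 0 & t 1 3 6 = 0].
  have E1 : X 5 * t 0 1 5 + X 3 * t 0 3 4 = 0.
    have <- : X 6 * t 0 0 2 + X 5 * t 5 0 1 + X 3 * t 3 4 0 = 0 := @eqs 0%N 6%N isT isT.
    by rewrite d12 (s312 0 1 5) (s231 0 3 4); ring.
  have E2 : (- X 4) * t 0 3 4 + X 5 * t 1 3 6 = 0.
    have <- : X 5 * t 3 6 1 + X 4 * t 4 3 0 + X 2 * t 2 3 3 = 0 := @eqs 3%N 5%N isT isT.
    by rewrite (s231 1 3 6) (s321 0 3 4) d23; ring.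
  have E3 : (- X 3) * t 1 3 6 + X 4 * t 0 1 5 = 0.
    have <- : X 4 * t 1 5 0 + X 3 * t 3 1 6 + X 1 * t 1 2 1 = 0 := @eqs 1%N 4%N isT isT.
    by rewrite (s231 0 1 5) (s213 1 3 6) d13; ring.
  apply: (three_cycle E1 E2 E3); rewrite ?mulf_neq0 ?oppr_eq0 ?Xn //; ring.
have [z016 z023 z135] : [/\ t 0 1 6 = 0, t 0 2 3 = 0 & t 1 3 5 = 0].
  have E1 : (- X 5) * t 0 1 6 + X 2 * t 0 2 3 = 0.
    have <- : X 5 * t 0 6 1 + X 4 * t 4 0 0 + X 2 * t 2 3 0 = 0 := @eqs 0%N 5%N isT isT.
    by rewrite (s132 0 1 6) d23 (s231 0 2 3); ring.
  have E2 : X 6 * t 0 2 3 + (- X 5) * t 1 3 5 = 0.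
    have <- : X 6 * t 3 0 2 + X 5 * t 5 3 1 + X 3 * t 3 4 3 = 0 := @eqs 3%N 6%N isT isT.
    by rewrite (s312 0 2 3) (s321 1 3 5) d13; ring.
  have E3 : X 2 * t 1 3 5 + X 6 * t 0 1 6 = 0.
    have <- : X 2 * t 1 3 5 + X 1 * t 1 1 4 + X 6 * t 6 0 1 = 0 := @eqs 1%N 2%N isT isT.
    by rewrite d12 (s312 0 1 6); ring.
  apply: (three_cycle E1 E2 E3); rewrite ?mulf_neq0 ?oppr_eq0 ?Xn //; ring.
have [z024 z056 z145] : [/\ t 0 2 4 = 0, t 0 5 6 = 0 & t 1 4 5 = 0].
  have E1 : X 1 * t 0 2 4 + X 5 * t 0 5 6 = 0.
    have <- : X 1 * t 0 2 4 + X 0 * t 0 0 3 + X 5 * t 5 6 0 = 0 := @eqs 0%N 1%N isT isT.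
    by rewrite (s231 0 5 6) X0; ring.
  have E2 : X 6 * t 0 5 6 + (- X 1) * t 1 4 5 = 0.
    have <- : X 2 * t 5 3 5 + X 1 * t 1 5 4 + X 6 * t 6 0 5 = 0 := @eqs 5%N 2%N isT isT.
    by rewrite d13 (s132 1 4 5) (s312 0 5 6); ring.
  have E3 : (- X 5) * t 1 4 5 + X 6 * t 0 2 4 = 0.
    have <- : X 6 * t 4 0 2 + X 5 * t 5 4 1 + X 3 * t 3 4 4 = 0 := @eqs 4%N 6%N isT isT.
    by rewrite (s312 0 2 4) (s321 1 4 5) d23; ring.
  apply: (three_cycle E1 E2 E3); rewrite ?mulf_neq0 ?oppr_eq0 ?Xn //; ring.
have [z025 z046 z345] : [/\ t 0 2 5 = 0, t 0 4 6 = 0 & t 3 4 5 = 0].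
  have E1 : (- X 2) * t 0 2 5 + X 3 * t 0 4 6 = 0.
    have <- : X 3 * t 0 4 6 + X 2 * t 2 0 5 + X 0 * t 0 1 0 = 0 := @eqs 0%N 3%N isT isT.
    by rewrite (s213 0 2 5) X0; ring.
  have E2 : X 6 * t 0 4 6 + (- X 2) * t 3 4 5 = 0.
    have <- : X 2 * t 4 3 5 + X 1 * t 1 4 4 + X 6 * t 6 0 4 = 0 := @eqs 4%N 2%N isT isT.
    by rewrite (s213 3 4 5) d23 (s312 0 4 6); ring.
  have E3 : X 3 * t 3 4 5 + X 6 * t 0 2 5 = 0.
    have <- : X 6 * t 5 0 2 + X 5 * t 5 5 1 + X 3 * t 3 4 5 = 0 := @eqs 5%N 6%N isT isT.
    by rewrite (s312 0 2 5) d12; ring.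
  apply: (three_cycle E1 E2 E3); rewrite ?mulf_neq0 ?oppr_eq0 ?Xn //; ring.
have [z125 z146 z234] : [/\ t 1 2 5 = 0, t 1 4 6 = 0 & t 2 3 4 = 0].
  have E1 : (- X 2) * t 1 2 5 + X 3 * t 1 4 6 = 0.
    have <- : X 3 * t 1 4 6 + X 2 * t 2 1 5 + X 0 * t 0 1 1 = 0 := @eqs 1%N 3%N isT isT.
    by rewrite (s213 1 2 5) X0; ring.
  have E2 : X 5 * t 1 4 6 + X 2 * t 2 3 4 = 0.
    have <- : X 5 * t 4 6 1 + X 4 * t 4 4 0 + X 2 * t 2 3 4 = 0 := @eqs 4%N 5%N isT isT.
    by rewrite (s231 1 4 6) d12; ring.
  have E3 : X 3 * t 2 3 4 + (- X 5) * t 1 2 5 = 0.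
    have <- : X 6 * t 2 0 2 + X 5 * t 5 2 1 + X 3 * t 3 4 2 = 0 := @eqs 2%N 6%N isT isT.
    by rewrite d13 (s321 1 2 5) (s231 2 3 4); ring.
  apply: (three_cycle E1 E2 E3); rewrite ?mulf_neq0 ?oppr_eq0 ?Xn //; ring.
have [z126 _ _] : [/\ t 1 2 6 = 0, t 1 4 5 = 0 & t 0 2 4 = 0].
  have E1 : X 6 * t 1 2 6 + X 4 * t 1 4 5 = 0.
    have <- : X 0 * t 1 1 3 + X 6 * t 6 1 2 + X 4 * t 4 5 1 = 0 := @eqs 1%N 0%N isT isT.
    by rewrite (s312 1 2 6) (s231 1 4 5) X0; ring.
  have E2 : (- X 5) * t 1 4 5 + X 6 * t 0 2 4 = 0.
    have <- : X 6 * t 4 0 2 + X 5 * t 5 4 1 + X 3 * t 3 4 4 = 0 := @eqs 4%N 6%N isT isT.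
    by rewrite (s312 0 2 4) (s321 1 4 5) d23; ring.
  have E3 : (- X 4) * t 0 2 4 + X 5 * t 1 2 6 = 0.
    have <- : X 5 * t 2 6 1 + X 4 * t 4 2 0 + X 2 * t 2 3 2 = 0 := @eqs 2%N 5%N isT isT.
    by rewrite (s231 1 2 6) (s321 0 2 4) d13; ring.
  apply: (three_cycle E1 E2 E3); rewrite ?mulf_neq0 ?oppr_eq0 ?Xn //; ring.
have [z236 _ _] : [/\ t 2 3 6 = 0, t 0 2 5 = 0 & t 0 4 6 = 0].
  have E1 : (- X 3) * t 2 3 6 + X 4 * t 0 2 5 = 0.
    have <- : X 4 * t 2 5 0 + X 3 * t 3 2 6 + X 1 * t 1 2 2 = 0 := @eqs 2%N 4%N isT isT.
    by rewrite (s231 0 2 5) (s213 2 3 6) d23; ring.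
  have E2 : (- X 2) * t 0 2 5 + X 3 * t 0 4 6 = 0.
    have <- : X 3 * t 0 4 6 + X 2 * t 2 0 5 + X 0 * t 0 1 0 = 0 := @eqs 0%N 3%N isT isT.
    by rewrite (s213 0 2 5) X0; ring.
  have E3 : X 4 * t 0 4 6 + X 2 * t 2 3 6 = 0.
    have <- : X 5 * t 6 6 1 + X 4 * t 4 6 0 + X 2 * t 2 3 6 = 0 := @eqs 6%N 5%N isT isT.
    by rewrite d12 (s231 0 4 6); ring.
  apply: (three_cycle E1 E2 E3); rewrite ?mulf_neq0 ?oppr_eq0 ?Xn //; ring.
have [z356 _ _] : [/\ t 3 5 6 = 0, t 2 3 4 = 0 & t 1 2 5 = 0].
  have E1 : X 5 * t 3 5 6 + (- X 1) * t 2 3 4 = 0.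
    have <- : X 1 * t 3 2 4 + X 0 * t 0 3 3 + X 5 * t 5 6 3 = 0 := @eqs 3%N 1%N isT isT.
    by rewrite (s213 2 3 4) (s231 3 5 6) X0; ring.
  have E2 : X 3 * t 2 3 4 + (- X 5) * t 1 2 5 = 0.
    have <- : X 6 * t 2 0 2 + X 5 * t 5 2 1 + X 3 * t 3 4 2 = 0 := @eqs 2%N 6%N isT isT.
    by rewrite d13 (s321 1 2 5) (s231 2 3 4); ring.
  have E3 : X 1 * t 1 2 5 + X 3 * t 3 5 6 = 0.
    have <- : X 4 * t 5 5 0 + X 3 * t 3 5 6 + X 1 * t 1 2 5 = 0 := @eqs 5%N 4%N isT isT.
    by rewrite d12; ring.
  apply: (three_cycle E1 E2 E3); rewrite ?mulf_neq0 ?oppr_eq0 ?Xn //; ring.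
(* The lines remain: u b is the weighted value on line b. *)
pose u b := X b * t b ((b + 1) %% 7) ((b + 3) %% 7).
have ueq b : (b < 7)%N -> u b + u ((b + 6) %% 7)%N + u ((b + 4) %% 7)%N = 0.
  by case: b => [|[|[|[|[|[|[|]]]]]]] // b7; apply: eqs.
have u0 : u 0%N = 0 by rewrite /u X0 mul0r.
have E0 : u 0%N + u 6%N + u 4%N = 0 := ueq 0%N isT.
have E1 : u 1%N + u 0%N + u 5%N = 0 := ueq 1%N isT.
have E2 : u 2%N + u 1%N + u 6%N = 0 := ueq 2%N isT.
have E3 : u 3%N + u 2%N + u 0%N = 0 := ueq 3%N isT.
have E4 : u 4%N + u 3%N + u 1%N = 0 := ueq 4%N isT.
have E5 : u 5%N + u 4%N + u 2%N = 0 := ueq 5%N isT.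
have E6 : u 6%N + u 5%N + u 3%N = 0 := ueq 6%N isT.
have un b : (0 < b < 7)%N -> u b = 0 -> t b ((b + 1) %% 7) ((b + 3) %% 7) = 0.
  by move=> b7 /eqP; rewrite mulf_eq0 (negPf (Xn b7)) => /eqP.
have S0 : u 1%N + u 2%N + u 3%N + u 4%N + u 5%N + u 6%N = 0.
  have /eqP : 3 * (u 1%N + u 2%N + u 3%N + u 4%N + u 5%N + u 6%N) = 0.
    transitivity ((u 0%N + u 6%N + u 4%N) + (u 1%N + u 0%N + u 5%N) + (u 2%N + u 1%N + u 6%N)
      + (u 3%N + u 2%N + u 0%N) + (u 4%N + u 3%N + u 1%N) + (u 5%N + u 4%N + u 2%N)
      + (u 6%N + u 5%N + u 3%N) - 3 * u 0%N); first by ring.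
    by rewrite E0 E1 E2 E3 E4 E5 E6 u0; ring.
  by rewrite mulf_eq0 pnatr_eq0 => /eqP.
have half (x : K) : 2 * x = 0 -> x = 0 by move/eqP; rewrite mulf_eq0 pnatr_eq0 => /eqP.
have z124 : t 1 2 4 = 0.
  apply: (un 1%N isT);
    apply: half; transitivity ((u 1%N + u 0%N + u 5%N) + (u 2%N + u 1%N + u 6%N)
    + (u 4%N + u 3%N + u 1%N) - (u 1%N + u 2%N + u 3%N + u 4%N + u 5%N + u 6%N) - u 0%N); first by ring.
  by rewrite E1 E2 E4 S0 u0; ring.
have z235 : t 2 3 5 = 0.
  apply: (un 2%N isT);
    apply: half; transitivity ((u 2%N + u 1%N + u 6%N) + (u 3%N + u 2%N + u 0%N)
    + (u 5%N + u 4%N + u 2%N) - (u 1%N + u 2%N + u 3%N + u 4%N + u 5%N + u 6%N) - u 0%N); first by ring.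
  by rewrite E2 E3 E5 S0 u0; ring.
have z346 : t 3 4 6 = 0.
  apply: (un 3%N isT);
    apply: half; transitivity ((u 3%N + u 2%N + u 0%N) + (u 4%N + u 3%N + u 1%N)
    + (u 6%N + u 5%N + u 3%N) - (u 1%N + u 2%N + u 3%N + u 4%N + u 5%N + u 6%N) - u 0%N); first by ring.
  by rewrite E3 E4 E6 S0 u0; ring.
have z045 : t 0 4 5 = 0.
  rewrite -s231; apply: (un 4%N isT);
    apply: half; transitivity ((u 4%N + u 3%N + u 1%N) + (u 5%N + u 4%N + u 2%N)
    + (u 0%N + u 6%N + u 4%N) - (u 1%N + u 2%N + u 3%N + u 4%N + u 5%N + u 6%N) - u 0%N); first by ring.
  by rewrite E4 E5 E0 S0 u0; ring.
have z156 : t 1 5 6 = 0.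
  rewrite -s231; apply: (un 5%N isT);
    apply: half; transitivity ((u 5%N + u 4%N + u 2%N) + (u 6%N + u 5%N + u 3%N)
    + (u 1%N + u 0%N + u 5%N) - (u 1%N + u 2%N + u 3%N + u 4%N + u 5%N + u 6%N) - u 0%N); first by ring.
  by rewrite E5 E6 E1 S0 u0; ring.
have z026 : t 0 2 6 = 0.
  rewrite -s312; apply: (un 6%N isT);
    apply: half; transitivity ((u 6%N + u 5%N + u 3%N) + (u 0%N + u 6%N + u 4%N)
    + (u 2%N + u 1%N + u 6%N) - (u 1%N + u 2%N + u 3%N + u 4%N + u 5%N + u 6%N) - u 0%N); first by ring.
  by rewrite E6 E0 E2 S0 u0; ring.
have z013 : t 0 1 3 = 0.
  move: eq0; rewrite z124 z235 z346 (s231 0%N 4%N 5%N) z045.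
  by rewrite (s231 1%N 5%N 6%N) z156 (s312 0%N 2%N 6%N) z026 !addr0.
case: k => [|[|[|[|[|[|[|k]]]]]]] //; case: j => [|[|[|[|[|[|[|j]]]]]]] //;
  case: i => [|[|[|[|[|[|[|i]]]]]]] //; move=> _ _ _; assumption.
Qed.

End Conormal.

End TangentSpace.

(** * The tangent space of the orbit of a punctured Fano form *)

Section Tangent.

Variable K : numClosedFieldType.
Notation e := (evec K).

(** The derivative at the identity of the action of GL7 on the Fano form with
   coefficients x. *)
Definition tangent (x : 'I_7 -> K) (Z : 'M[K]_7) : ext K 7 3 :=
  \sum_i x i *: (wedge3 (Z *m e i) (e (i + 1)) (e (i + 3%:R))
               + wedge3 (e i) (Z *m e (i + 1)) (e (i + 3%:R))
               + wedge3 (e i) (e (i + 1)) (Z *m e (i + 3%:R))).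

Lemma wedge3D2 u v v' z : wedge3 u (v + v') z = wedge3 u v z + wedge3 u v' z :> ext K 7 3.
Proof. by rewrite /wedge3 lmulvDl lmulvDr. Qed.

Lemma wedge3D3 u v z z' : wedge3 u v (z + z') = wedge3 u v z + wedge3 u v z' :> ext K 7 3.
Proof. by rewrite /wedge3 lmulvDl !lmulvDr. Qed.

Lemma wedge3Z2 a u v z : wedge3 u (a *: v) z = a *: wedge3 u v z :> ext K 7 3.
Proof. by rewrite /wedge3 lmulvZl lmulvZr. Qed.

Lemma wedge3Z3 a u v z : wedge3 u v (a *: z) = a *: wedge3 u v z :> ext K 7 3.
Proof. by rewrite /wedge3 lmulvZl !lmulvZr. Qed.

Lemma tangentD x Y Z : tangent x (Y + Z) = tangent x Y + tangent x Z.
Proof.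
rewrite -big_split; apply: eq_bigr => i _ /=.
rewrite !mulmxDl wedge3Dl wedge3D2 wedge3D3 -scalerDr; congr (_ *: _).
by rewrite [LHS](AC (2*2*2) ((1*3*5)*(2*4*6))).
Qed.

Lemma tangentZ x a Z : tangent x (a *: Z) = a *: tangent x Z.
Proof.
rewrite scaler_sumr; apply: eq_bigr => i _.
by rewrite -!scalemxAl wedge3Zl wedge3Z2 wedge3Z3 -!scalerDr scalerA mulrC -scalerA.
Qed.

Lemma tangent_sum x I (r : seq I) (Z : I -> 'M[K]_7) :
  tangent x (\sum_(i <- r) Z i) = \sum_(i <- r) tangent x (Z i).
Proof.
elim/big_rec2: _ => [|i a b _ <-]; last by rewrite tangentD.
by have := tangentZ x 0 0; rewrite !scale0r.
Qed.

(** The vanishing on the tangent vectors of the elementary matrices gives the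
   equations studied above, after renumbering the basis by m. *)
Lemma fano_conormal (x : 'I_7 -> K) m (theta : 'cV[K]_#|{: ksub 7 3}|) :
  (forall i, (x i == 0) = (i == m)) ->
  (forall Z, tangent x Z *m theta = 0) -> fano_form K *m theta = 0 -> theta = 0.
Proof.
move=> xm tanZ fano0; pose f (w : ext K 7 3) := (w *m theta) 0 0.
have fD w w' : f (w + w') = f w + f w' by rewrite /f mulmxDl mxE.
have fZ a w : f (a *: w) = a * f w by rewrite /f -scalemxAl mxE.
have f0 : f 0 = 0 by rewrite /f mul0mx mxE.
have fN w : f (- w) = - f w by rewrite -scaleN1r fZ mulN1r.
have fs (F : 'I_7 -> ext K 7 3) : f (\sum_i F i) = \sum_i f (F i).
  by elim/big_rec2: _ => [//|i a b _ <-]; rewrite fD.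
set E := shifted_evec K m; pose X (k : nat) := x (m + inord k).
pose t (i j k : nat) := f (wedge3 (E i) (E j) (E k)).
have t0 (i j k : nat) : (i < j)%N -> (j < k)%N -> (k < 7)%N -> t i j k = 0.
  apply: (@fano_conormal0 K t X).
  - by move=> a b c; rewrite /t wedge3C12 fN.
  - by move=> a b c; rewrite /t wedge3C23 fN.
  - by move=> a b; rewrite /t wedge3_eq12 f0.
  - by apply/eqP; rewrite /X xm addr_inord7_eq.
  - by move=> a /andP[a0 a7]; rewrite /X xm addr_inord7_eq // -lt0n.
  - move=> a b a7 b7.
    have := congr1 (fun M : 'M[K]_1 => M 0 0) (tanZ (delta_mx (m + inord a) (m + inord b))).
    rewrite -[LHS]/(f _) mxE fs.
    under eq_bigr => l _ do rewrite fZ !fD.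
    have de c : delta_mx (m + inord a) (m + inord b) *m e c = (m + inord b == c)%:R *: E a.
      rewrite /e mul_delta_mx_cond; case: (_ == _); by rewrite ?scale1r ?scale0r.
    under eq_bigr => l _ do rewrite !de wedge3Zl wedge3Z2 wedge3Z3 !fZ !mulrDr.
    rewrite !big_split /=.
    rewrite (bigD1 (m + inord b)) //= eqxx mul1r big1 ?addr0; last first.
      by move=> l /negPf ib; rewrite eq_sym ib mul0r mulr0.
    rewrite (bigD1 (m + inord b - 1)) //= subrK eqxx mul1r big1 ?addr0; last first.
      by move=> l ib; rewrite -subr_eq eq_sym (negPf ib) mul0r mulr0.
    rewrite (bigD1 (m + inord b - 3%:R)) //= subrK eqxx mul1r big1 ?addr0; last first.
      by move=> l ib; rewrite -subr_eq eq_sym (negPf ib) mul0r mulr0.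
    have e1 : 1 = inord 1 :> 'I_7 := esym (inord7_nat (isT : 1 < 7)%N).
    have e3 : 3%:R = inord 3 :> 'I_7 := esym (inord7_nat (isT : 3 < 7)%N).
    have e6 : -1 = inord 6 :> 'I_7 by apply/val_inj; rewrite /= inordK.
    have e4 : - 3%:R = inord 4 :> 'I_7 by apply/val_inj; rewrite /= inordK.
    have m31 : (m + inord b - 3%:R + 1) = m + inord ((b + 5) %% 7).
      by rewrite e4 e1 -!addrA !inord7D ?ltn_pmod.
    have m13 : (m + inord b - 1 + 3%:R) = m + inord ((b + 2) %% 7).
      by rewrite e6 e3 -!addrA !inord7D ?ltn_pmod.
    have m1 : m + inord b - 1 = m + inord ((b + 6) %% 7) by rewrite e6 -addrA inord7D.
    have m3 : m + inord b - 3%:R = m + inord ((b + 4) %% 7) by rewrite e4 -addrA inord7D.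
    have p1 : m + inord b + 1 = m + inord ((b + 1) %% 7) by rewrite e1 -addrA inord7D.
    have p3 : m + inord b + 3%:R = m + inord ((b + 3) %% 7) by rewrite e3 -addrA inord7D.
    by rewrite m31 m13 m1 m3 p1 p3.
  - have := congr1 (fun M : 'M[K]_1 => M 0 0) fano0.
    rewrite -[LHS]/(f _) mxE /fano_form /fano fs (reindex_inj (addrI m)) /=.
    pose F (k : nat) := t k ((k + 1) %% 7)%N ((k + 3) %% 7)%N.
    rewrite (_ : \sum_(i < 7) _ = \sum_(i < 7) F i); first by rewrite sum_ord7.
    by apply: eq_bigr => l _; rewrite scale1r fano_line_shift.
have t12 i j k : t j i k = - t i j k by rewrite /t wedge3C12 fN.
have t23 i j k : t i k j = - t i j k by rewrite /t wedge3C23 fN.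
have tall i j k : (i < 7)%N -> (j < 7)%N -> (k < 7)%N -> t i j k = 0.
  move=> i7 j7 k7.
  have [ij|ji|->] := ltngtP i j; last by rewrite /t wedge3_eq12.
  - have [jk|kj|->] := ltngtP j k; [exact: t0| |by rewrite /t wedge3_eq23].
    rewrite t23; have [ik|ki|->] := ltngtP i k; [by rewrite t0 ?oppr0| |by rewrite /t wedge3_eq12 f0 oppr0].
    by rewrite t12 t0 ?oppr0.
  - rewrite t12; have [ik|ki|->] := ltngtP i k; [by rewrite t0 ?oppr0| |by rewrite /t wedge3_eq23 f0 oppr0].
    rewrite t23; have [jk|kj|->] := ltngtP j k; [by rewrite t0 ?oppr0| |by rewrite /t wedge3_eq12 f0 !oppr0].
    by rewrite t12 t0 ?oppr0.
(* The functional theta is determined by its values on increasing triples. *)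
apply/colP => s; rewrite [RHS]mxE.
have -> : theta s 0 = f (ebasis K 3 (supp s)).
  rewrite /f mxE (bigD1 s) //= mxE eqxx mul1r big1 ?addr0 // => r rs.
  by rewrite mxE (inj_eq (@supp_inj 7 3)) (negPf rs) mul0r.
have [a [b [c [abc ->]]]] := set3_sorted (card_supp s).
rewrite -wedge3_evec //.
have eE (l : 'I_7) : e l = E (val (l - m)) by rewrite /E /shifted_evec inord_val addrC subrK.
by rewrite !eE; apply: tall; apply: ltn_ord.
Qed.

(** Transversality: the tangent space of the orbit of a punctured Fano form is
   a hyperplane that does not contain the full Fano form.  By duality this is
   the vanishing of the conormal functionals. *)
Lemma tangent_full (x : 'I_7 -> K) m : (forall i, (x i == 0) = (i == m)) ->
  forall w, exists Z a, tangent x Z + a *: fano_form K = w.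
Proof.
move=> xm w.
pose A1 : 'M[K]_(7 * 7, _) := \matrix_(r, s) tangent x (vec_mx (delta_mx 0 r)) 0 s.
pose A := col_mx A1 (fano_form K).
have tanE (c : 'rV[K]_(7 * 7)) : c *m A1 = tangent x (vec_mx c).
  rewrite [c in RHS]row_sum_delta linear_sum /= tangent_sum.
  apply/rowP => s; rewrite mxE summxE; apply: eq_bigr => r _.
  by rewrite linearZ tangentZ !mxE.
have full : row_full A.
  rewrite /row_full -mxrank_tr -/(row_free A^T) -kermx_eq0; apply/eqP/row_matrixP => r.
  rewrite row0; have /sub_kermxP : (row r (kermx A^T) <= kermx A^T)%MS by apply: row_sub.
  set y := row r _ => yA.
  have : A *m y^T = 0 by apply: trmx_inj; rewrite trmx_mul trmxK yA trmx0.
  rewrite mul_col_mx => /eqP; rewrite -col_mx0 => /eqP/eq_col_mx[A1y fy].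
  have yT : y^T = 0.
    apply: (fano_conormal xm) fy => Z.
    by rewrite -[Z]mxvecK -tanE -mulmxA A1y mulmx0.
  by rewrite -[y]trmxK yT trmx0.
have /submxP[c wE] := submx_full w full.
exists (vec_mx (lsubmx c)), (rsubmx c 0 0).
rewrite wE -{3}[c]hsubmxK mul_row_col -tanE; congr (_ + _).
by rewrite [rsubmx c in RHS]mx11_scalar mul_scalar_mx.
Qed.

End Tangent.

(** * First-order jets of polynomials *)

Section Jets.

Variable K : numClosedFieldType.
Local Notation P := {poly K}.

(** First-order jets: jet n A A' a d says that A has constant term a and that
   A' is A perturbed by d t^(n+1), up to higher order. *)
Definition jet n (A A' : P) (a d : K) :=
  exists U V : P, A = a%:P + U * 'X /\ A' = A + (d%:P + V * 'X) * ('X * 'X^n).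

Lemma jetD n A A' a d B B' b e : jet n A A' a d -> jet n B B' b e ->
  jet n (A + B) (A' + B') (a + b) (d + e).
Proof.
move=> [U [V [-> ->]]] [W [Y [-> ->]]]; exists (U + W), (V + Y).
by rewrite !polyCD; split; ring.
Qed.

Lemma jetN n A A' a d : jet n A A' a d -> jet n (- A) (- A') (- a) (- d).
Proof.
by move=> [U [V [-> ->]]]; exists (- U), (- V); rewrite !polyCN; split; ring.
Qed.

Lemma jetM n A A' a d B B' b e : jet n A A' a d -> jet n B B' b e ->
  jet n (A * B) (A' * B') (a * b) (d * b + a * e).
Proof.
move=> [U [V [-> ->]]] [W [Y [-> ->]]].
exists (a%:P * W + b%:P * U + U * W * 'X),
  (V * (b%:P + W * 'X) + Y * (a%:P + U * 'X) + (d%:P + V * 'X) * (e%:P + Y * 'X) * 'X^n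
   + d%:P * W + e%:P * U).
by rewrite !(polyCD, polyCM); split; ring.
Qed.

Lemma jetC n c : jet n c%:P c%:P c 0.
Proof. by exists 0, 0; rewrite !(mul0r, addr0). Qed.

Lemma jet_sum n I (r : seq I) (A A' : I -> P) (a d : I -> K) :
  (forall i, jet n (A i) (A' i) (a i) (d i)) ->
  jet n (\sum_(i <- r) A i) (\sum_(i <- r) A' i) (\sum_(i <- r) a i) (\sum_(i <- r) d i).
Proof.
move=> j; elim: r => [|i r IH]; first by rewrite !big_nil; apply: jetC.
by rewrite !big_cons; apply: jetD.
Qed.

Lemma jet_det3 n m (u v w u' v' w' : 'I_m -> P) (u0 v0 w0 du dv dw : 'I_m -> K) a b c :
  (forall i, jet n (u i) (u' i) (u0 i) (du i)) ->
  (forall i, jet n (v i) (v' i) (v0 i) (dv i)) ->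
  (forall i, jet n (w i) (w' i) (w0 i) (dw i)) ->
  jet n (det3 u v w a b c) (det3 u' v' w' a b c) (det3 u0 v0 w0 a b c)
    (det3 du v0 w0 a b c + det3 u0 dv w0 a b c + det3 u0 v0 dw a b c).
Proof.
move=> ju jv jw; rewrite /det3.
have E x y : x = y -> jet n (det3 u v w a b c) (det3 u' v' w' a b c) (det3 u0 v0 w0 a b c) x ->
    jet n (det3 u v w a b c) (det3 u' v' w' a b c) (det3 u0 v0 w0 a b c) y by move=> ->.
apply: E; last by do ![apply: jetD | apply: jetN | apply: jetM | apply: ju | apply: jv | apply: jw].
ring.
Qed.

End Jets.

(** * Congruences between values of polynomials *)

Section PolynomialCongruence.

Variables (K : numClosedFieldType) (N : nat).
Local Notation P := {poly K}.

Lemma poly_vanish (p : P) : (forall x, p.[x] = 0) -> p = 0.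
Proof.
move=> p0; apply/eqP; apply: contraT => pn0.
have /max_poly_roots : p != 0 by [].
move=> /(_ [seq i%:R | i <- iota 0 (size p)]); rewrite size_map size_iota ltnn; apply.
  by apply/allP => x _; rewrite /root p0.
by rewrite map_inj_uniq ?iota_uniq // => i j /eqP; rewrite eqr_nat => /eqP.
Qed.

Lemma horner_mmap (q : 'I_N -> P) (Q : {mpoly K[N]}) x :
  (mmap polyC q Q).[x] = Q.@[fun s => (q s).[x]].
Proof.
elim/mpolyind: Q => [|c m Q _ _ IH]; first by rewrite mmap0 meval0 horner0.
rewrite mmapD mevalD mmapZ mevalZ hornerD hornerCM IH mmapX mevalX; congr (_ * _ + _).
by rewrite /mmap1 horner_prod; apply: eq_bigr => i _; rewrite horner_exp.
Qed.

Lemma dvdp_subM (d a a' b b' : P) : d %| a - a' -> d %| b - b' -> d %| a * b - a' * b'.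
Proof.
move=> da db; have -> : a * b - a' * b' = (a - a') * b + a' * (b - b') by ring.
by apply: dvdp_add; [apply: dvdp_mulr | apply: dvdp_mull].
Qed.

Lemma dvdp_mmap (d : P) (q q' : 'I_N -> P) (Q : {mpoly K[N]}) :
  (forall s, d %| q s - q' s) -> d %| mmap polyC q Q - mmap polyC q' Q.
Proof.
move=> dq; elim/mpolyind: Q => [|c m Q _ _ IH]; first by rewrite !mmap0 subrr dvdp0.
rewrite !mmapD !mmapZ !mmapX [X in d %| X](_ : _ = c%:P * (mmap1 q m - mmap1 q' m)
  + (mmap polyC q Q - mmap polyC q' Q)); last by ring.
apply: dvdp_add => //; apply: dvdp_mull; rewrite /mmap1.
elim/big_ind2: _ => [|a b a' b' ab ab'|i _]; first by rewrite subrr dvdp0.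
  exact: dvdp_subM.
elim: (m i) => [|e IHe]; first by rewrite subrr dvdp0.
by rewrite !exprS; apply: dvdp_subM.
Qed.

Lemma dvdp_horner_mmap (d : P) (q q' : 'I_N -> P) (x : P) (B : {poly {mpoly K[N]}}) :
  (forall s, d %| q s - q' s) ->
  d %| (map_poly (mmap polyC q) B).[x] - (map_poly (mmap polyC q') B).[x].
Proof.
move=> dq; elim/poly_ind: B => [|B c IH]; first by rewrite !rmorph0 !horner0 subrr dvdp0.
rewrite !rmorphD !rmorphM /= !map_polyX !map_polyC /= !hornerMXaddC.
rewrite [X in d %| X](_ : _ = ((map_poly (mmap polyC q) B).[x] - (map_poly (mmap polyC q') B).[x]) * x
   + (mmap polyC q c - mmap polyC q' c)); last by ring.
by apply: dvdp_add; [apply: dvdp_mulr | apply: dvdp_mmap].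
Qed.

Lemma horner_map_mmap (q : 'I_N -> P) (x : P) (B : {poly {mpoly K[N]}}) e :
  ((map_poly (mmap polyC q) B).[x]).[e] = (map_poly (meval (fun s => (q s).[e])) B).[x.[e]].
Proof.
elim/poly_ind: B => [|B c IH]; first by rewrite !rmorph0 !horner0.
rewrite !rmorphD !rmorphM /= !map_polyX !map_polyC /= !hornerMXaddC hornerD hornerM IH.
by rewrite horner_mmap.
Qed.

End PolynomialCongruence.

(** * Newton iteration along a line through the base form *)

Section Newton.

Variable K : numClosedFieldType.
Local Notation P := {poly K}.
Local Notation N := #|{: ksub 7 3}|.
Local Notation p0 := (fano_form K).

(** The index set of the s-th basis 3-vector, in increasing order. *)
Definition tri (s : 'I_N) (j : nat) : 'I_7 := nth ord0 (enum (supp s)) j.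

Lemma triP s : (tri s 0 < tri s 1 < tri s 2)%N /\ supp s = [set tri s 0; tri s 1; tri s 2].
Proof.
have [a [b [c [abc sE]]]] := set3_sorted (card_supp s).
by rewrite /tri sE enum_set3.
Qed.

Lemma wedge3_tri u v z s : (wedge3 u v z : ext K 7 3) 0 s =
  det3 (vcoord u) (vcoord v) (vcoord z) (tri s 0) (tri s 1) (tri s 2).
Proof. by have [lt sE] := triP s; rewrite -ecoord_supp sE wedge3_coord. Qed.

(** Over a polynomial ring this is the image of a Fano form under a matrix that
   depends on a parameter; the exterior algebra itself is set up over fields. *)
Definition orbit_coord (R : comPzRingType) (x : 'I_7 -> R) (g : 'M[R]_7) (s : 'I_N) : R :=
  \sum_i x i * det3 (g^~ i) (g^~ (i + 1)) (g^~ (i + 3%:R)) (tri s 0) (tri s 1) (tri s 2).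

Lemma extmap_fano (x : 'I_7 -> K) (g : 'M[K]_7) s : (extmap g (fano x)) 0 s = orbit_coord x g s.
Proof.
rewrite /fano extmap_sum summxE; apply: eq_bigr => i _.
rewrite extmapZ mxE extmap_wedge3 wedge3_tri; congr (_ * _).
by rewrite /det3 /vcoord -!col_mulevec !mxE.
Qed.

Lemma horner_orbit_coord (x : 'I_7 -> K) (g : 'M[P]_7) s e :
  (orbit_coord (fun i => (x i)%:P) g s).[e] = (extmap (map_mx (horner_eval e) g) (fano x)) 0 s.
Proof.
rewrite extmap_fano /orbit_coord horner_sum; apply: eq_bigr => i _.
by rewrite /det3 !mxE /horner_eval !hornerE.
Qed.

Lemma fanoE (x : 'I_7 -> K) s : fano x 0 s = orbit_coord x 1%:M s.
Proof. by rewrite -extmap_fano extmap1. Qed.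

Lemma poly_split0 (p : P) : exists u, p = p.[0]%:P + u * 'X.
Proof.
elim/poly_ind: p => [|p c _]; first by exists 0; rewrite horner0 mul0r addr0.
by exists p; rewrite hornerMXaddC mulr0 add0r addrC.
Qed.

(** Starting from the identity and the root r, suppose that g (fano x) agrees with
   y0 + 'X y1 + xi p0 up to order n and let h be the coefficient of the error in
   degree n+1.  As g is the identity at 'X = 0, adding Z 'X^(n+1) to g and
   subtracting a 'X^(n+1) from xi changes this coefficient by
   tangent x Z + a p0, and tangent_full provides Z and a that cancel h. *)
Lemma newton_curve (x : 'I_7 -> K) m (y0 y1 : ext K 7 3) r :
  (forall i, (x i == 0) = (i == m)) -> fano x = y0 + r *: p0 ->
  forall n, exists (g : 'M[P]_7) (xi : P),
  [/\ (forall a b, exists u, g a b = (a == b)%:R%:P + u * 'X), xi.[0] = r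
    & forall s, 'X^(n.+1) %| orbit_coord (fun i => (x i)%:P) g s -
         ((y0 0 s)%:P + 'X * (y1 0 s)%:P + xi * (p0 0 s)%:P)].
Proof.
move=> xm xE; elim=> [|n [g [xi [g1 xi0 IH]]]].
  exists 1%:M, r%:P; split; [by move=> a b; exists 0; rewrite mxE mul0r addr0; case: eqP|by rewrite hornerC|].
  move=> s; have -> : orbit_coord (fun i => (x i)%:P) 1%:M s = (fano x 0 s)%:P.
    rewrite fanoE /orbit_coord rmorph_sum; apply: eq_bigr => i _.
    by rewrite rmorphM /det3 !mxE !(rmorphM, rmorphB, rmorphD) /= !polyC_natr.
  rewrite xE !mxE polyCD polyCM expr1.
  set u := _ - _; have -> : u = - (y1 0 s)%:P * 'X by rewrite /u; ring.
  by rewrite dvdp_mull.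
(* The error at order n + 1. *)
have /fin_all_exists[h hE] s : exists h : P, orbit_coord (fun i => (x i)%:P) g s -
         ((y0 0 s)%:P + 'X * (y1 0 s)%:P + xi * (p0 0 s)%:P) = h * 'X^(n.+1).
  by apply/dvdpP.
have [Z [a Za]] := tangent_full xm (\row_s - ((h s).[0])).
exists (g + 'X^(n.+1) *: map_mx polyC Z), (xi - a%:P * 'X^(n.+1)); split.
- move=> i j; have [u gE] := g1 i j; exists (u + 'X^n * (Z i j)%:P).
  by rewrite !mxE gE exprSr; ring.
- by rewrite hornerD hornerN hornerM hornerXn expr0n /= mulr0 subr0.
move=> s; have := congr1 (fun w : 'rV_N => w 0 s) Za.
have [U [V [_ jE]]] : jet n (orbit_coord (fun i => (x i)%:P) g s)
   (orbit_coord (fun i => (x i)%:P) (g + 'X^(n.+1) *: map_mx polyC Z) s)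
   (fano x 0 s) (tangent x Z 0 s).
  rewrite fanoE summxE; apply: jet_sum => i.
  have jg c b : jet n (g c b) ((g + 'X^(n.+1) *: map_mx polyC Z) c b) (1%:M c b) (Z c b).
    have [u gE] := g1 c b; exists u, 0; rewrite !mxE gE; split; first by case: (c == b).
    by rewrite exprS; ring.
  have rowD (w w' : 'rV[K]_N) : (w + w') 0 s = w 0 s + w' 0 s by rewrite mxE.
  have rowZ c (w : 'rV[K]_N) : (c *: w) 0 s = c * w 0 s by rewrite mxE.
  rewrite rowZ !rowD !wedge3_tri.
  have zE c b : vcoord (Z *m evec K c) b = Z b c by rewrite /vcoord -col_mulevec mxE.
  have eE c b : vcoord (evec K c) b = 1%:M b c by rewrite /vcoord !mxE andbT.
  set d := (d in jet n _ _ _ d).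
  have -> : d = 0 * det3 (1%:M^~ i) (1%:M^~ (i + 1)) (1%:M^~ (i + 3%:R)) (tri s 0) (tri s 1) (tri s 2)
     + x i * (det3 (Z^~ i) (1%:M^~ (i + 1)) (1%:M^~ (i + 3%:R)) (tri s 0) (tri s 1) (tri s 2)
       + det3 (1%:M^~ i) (Z^~ (i + 1)) (1%:M^~ (i + 3%:R)) (tri s 0) (tri s 1) (tri s 2)
       + det3 (1%:M^~ i) (1%:M^~ (i + 1)) (Z^~ (i + 3%:R)) (tri s 0) (tri s 1) (tri s 2)).
    by rewrite mul0r add0r /d /det3 !zE !eE.
  by apply: jetM; [apply: jetC | apply: jet_det3].
rewrite jE [LHS]mxE [X in _ + X]mxE [RHS]mxE => tE.
have [u uE] := poly_split0 (h s).
have -> : orbit_coord (fun i => (x i)%:P) g s + ((tangent x Z 0 s)%:P + V * 'X) * ('X * 'X^n) -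
   ((y0 0 s)%:P + 'X * (y1 0 s)%:P + (xi - a%:P * 'X^(n.+1)) * (p0 0 s)%:P) =
   (h s * 'X^(n.+1) + ((tangent x Z 0 s)%:P + V * 'X + a%:P * (p0 0 s)%:P) * 'X^(n.+1)).
  by rewrite -hE exprS; ring.
have tP : (tangent x Z 0 s)%:P + a%:P * (p0 0 s)%:P = - ((h s).[0])%:P :> P.
  by rewrite -polyCM -polyCD tE polyCN.
set w := (w in _ %| w); have -> : w = (u + V) * 'X^(n.+2); last exact/dvdp_mull/dvdpp.
rewrite /w {1}uE.
have -> : (tangent x Z 0 s)%:P + V * 'X + a%:P * (p0 0 s)%:P = - ((h s).[0])%:P + V * 'X.
  by rewrite -tP; ring.
by rewrite [in RHS]exprS; ring.
Qed.

End Newton.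

(** * Polynomials that vanish everywhere *)

Section Vanishing.

Variable K : numClosedFieldType.
Local Notation P := {poly K}.

Lemma digits_inj n D (f g : nat -> nat) :
  (forall i, i < n -> f i < D)%N -> (forall i, i < n -> g i < D)%N ->
  (\sum_(i < n) f i * D ^ i = \sum_(i < n) g i * D ^ i)%N ->
  forall i, (i < n)%N -> f i = g i.
Proof.
elim: n f g => [//|n IH] f g fD gD.
have shift (h : nat -> nat) : (\sum_(i < n.+1) h i * D ^ i = h 0 + (\sum_(i < n) h i.+1 * D ^ i) * D)%N.
  rewrite big_ord_recl expn0 muln1 big_distrl /=; congr (_ + _)%N.
  by apply: eq_bigr => i _; rewrite /bump /= add1n expnS mulnA mulnAC.
have D0 : (0 < D)%N by apply: leq_ltn_trans (fD 0%N isT).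
rewrite !shift => E.
have E0 : f 0%N = g 0%N.
  have := congr1 (modn^~ D) E.
  by rewrite /= ![(_ + _ * D)%N]addnC !modnMDl !modn_small ?fD ?gD.
have E1 : (\sum_(i < n) f i.+1 * D ^ i = \sum_(i < n) g i.+1 * D ^ i)%N.
  by move/eqP: E; rewrite E0 eqn_add2l eqn_pmul2r // => /eqP.
case=> [//|i] i_n; apply: (IH (fun i => f i.+1) (fun i => g i.+1)) => // j jn.
  exact: fD.
exact: gD.
Qed.

(** Kronecker substitution: distinct monomials of bounded degree become
   distinct powers of a single variable. *)
Lemma mpoly_vanish n (Q : {mpoly K[n]}) : (forall v, Q.@[v] = 0) -> Q = 0.
Proof.
move=> Q0; pose D := msize Q.
pose k (m : 'X_{1..n}) := (\sum_(i < n) m i * D ^ i)%N.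
have QX : \sum_(m <- msupp Q) (Q@_m)%:P * 'X^(k m) = 0 :> P.
  transitivity (mmap polyC (fun i : 'I_n => 'X^(D ^ i)) Q).
    apply: eq_bigr => m _; congr (_ * _); rewrite /mmap1 /k -prodrXr.
    by apply: eq_bigr => i _; rewrite -exprM mulnC.
  by apply: poly_vanish => x; rewrite horner_mmap Q0.
apply/mpolyP => m; rewrite mcoeff0.
have [mQ|] := boolP (m \in msupp Q); last by rewrite -mcoeff_eq0 => /eqP.
have := congr1 (fun p : P => p`_(k m)) QX; rewrite coef0 coef_sum.
rewrite (bigD1_seq m) ?msupp_uniq //= coefCM coefXn eqxx mulr1.
rewrite big_seq_cond big1 ?addr0 // => m' /andP[m'Q m'm].
rewrite coefCM coefXn; case: eqP => [E|_]; last by rewrite mulr0.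
case/negP: m'm; apply/eqP/mnmP => i.
pose digit (m1 : 'X_{1..n}) (j : nat) := oapp (fun i : 'I_n => m1 i) 0%N (insub j).
have digitE m1 (j : 'I_n) : digit m1 j = m1 j by rewrite /digit valK.
have lt m1 : m1 \in msupp Q -> forall j, (j < n)%N -> (digit m1 j < D)%N.
  move=> m1Q j jn; rewrite -[j]/(val (Ordinal jn)) digitE.
  apply: leq_ltn_trans (msize_mdeg_lt m1Q).
  by rewrite mdegE (bigD1 (Ordinal jn)) //= leq_addr.
rewrite -!digitE; apply: (digits_inj (lt _ m'Q) (lt _ mQ)) (ltn_ord i).
by under eq_bigr => j _ do rewrite digitE; under [RHS]eq_bigr => j _ do rewrite digitE.
Qed.

End Vanishing.

(** * Polynomials that vanish on the cone *)

Section Transversality.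

Variable K : numClosedFieldType.
Local Notation P := {poly K}.
Local Notation N := #|{: ksub 7 3}|.
Local Notation D := {mpoly K[N]}.
Local Notation p0 := (fano_form K).

(** On the base line through this form, the parameter -i makes the coefficient
   of line i, and no other, vanish. *)
Definition base_form : ext K 7 3 := fano (fun i => (i : nat)%:R).
Definition base_root (i : 'I_7) : K := - (i : nat)%:R.

Lemma base_root_inj : injective base_root.
Proof. by move=> i j /oppr_inj/eqP; rewrite eqr_nat => /eqP/val_inj. Qed.

Lemma base_fano (i : 'I_7) :
  fano (fun l : 'I_7 => (l : nat)%:R - (i : nat)%:R) = base_form + base_root i *: p0.
Proof.
rewrite /fano_form /base_form /fano scaler_sumr -big_split; apply: eq_bigr => l _ /=.
by rewrite scale1r scalerBl scaleNr.
Qed.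

Lemma base_fano_eq0 (i l : 'I_7) : ((l : nat)%:R - (i : nat)%:R == 0 :> K) = (l == i).
Proof. by rewrite subr_eq0 eqr_nat. Qed.

(** Here B is a polynomial in y and in the position X on the line y + X p0. *)
Definition vanish_cone (B : {poly D}) := forall (y : ext K 7 3) x,
  cone (y + x *: p0) -> (map_poly (meval (fun s => y 0 s)) B).[x] = 0.

Definition base_line (y : ext K 7 3) (s : 'I_N) : P :=
  (base_form 0 s)%:P + 'X * (y 0 s)%:P.

(** Newton iteration provides q(t) and xi(t) such that q + xi p0 is on the cone
   for every t, q agrees with the base line up to order k, and xi starts at the
   i-th root.  So B(q, xi) = 0, while B(base line, xi) = t^k H(xi) is congruent to
   it modulo t^(k+1): hence H(xi) vanishes at t = 0. *)
Lemma vanish_cone_root (B : {poly D}) : vanish_cone B ->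
  forall y k (H : {poly P}), map_poly (mmap polyC (base_line y)) B = ('X^k)%:P * H ->
  forall i, (map_poly (horner_eval 0) H).[base_root i] = 0.
Proof.
move=> JB y k H BH i.
pose x (l : 'I_7) : K := (l : nat)%:R - (i : nat)%:R.
have [g [xi [_ xi0 gxi]]] := newton_curve y (base_fano_eq0 i) (base_fano i) k.
pose q s := orbit_coord (fun i => (x i)%:P) g s - xi * (p0 0 s)%:P.
have qB : (map_poly (mmap polyC q) B).[xi] = 0.
  apply: poly_vanish => e; rewrite horner_map_mmap.
  pose ye : ext K 7 3 := \row_s (q s).[e].
  have <- : (map_poly (meval (fun s => ye 0 s)) B).[xi.[e]] = 0.
    apply: JB; have -> : ye + xi.[e] *: p0 = extmap (map_mx (horner_eval e) g) (fano x).
      apply/rowP => s; rewrite -horner_orbit_coord /ye [LHS]mxE [X in X + _]mxE [X in _ + X]mxE.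
      by rewrite /q hornerD hornerN hornerM hornerC subrK.
    by apply/cone_extmap/(@cone_fano _ _ i); apply: base_fano_eq0.
  by congr horner; apply: eq_map_poly => Q; apply: meval_eq => s; rewrite mxE.
have : 'X^(k.+1) %| (map_poly (mmap polyC q) B).[xi] - (map_poly (mmap polyC (base_line y)) B).[xi].
  apply: dvdp_horner_mmap => s; rewrite [X in _ %| X](_ : _ = orbit_coord (fun i => (x i)%:P) g s -
    ((base_form 0 s)%:P + 'X * (y 0 s)%:P + xi * (p0 0 s)%:P)) //.
  by rewrite /q /base_line; ring.
rewrite qB sub0r BH hornerM hornerC dvdpNr exprSr dvdp_mul2l; last by rewrite monic_neq0 ?monicXn.
rewrite (_ : 'X = 'X - 0%:P); last by rewrite polyC0 subr0.
rewrite dvdp_XsubCl => /rootP HX.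
by rewrite -xi0 -[xi.[0]]/(horner_eval 0 xi) horner_map.
Qed.

(** Otherwise some coefficient of M, a nonzero polynomial in t, would be divisible
   by every power of t. *)
Lemma poly2_eq0 (M : {poly P}) :
  (forall k H, M = ('X^k)%:P * H -> map_poly (horner_eval 0) H = 0) -> M = 0.
Proof.
move=> M0.
have Mk k : exists H : {poly P}, M = ('X^k)%:P * H.
  elim: k => [|k [H MH]]; first by exists M; rewrite expr0 mul1r.
  have H0 := M0 _ _ MH.
  have /fin_all_exists[u uE] (i : 'I_(size H)) : exists u : P, H`_i = u * 'X.
    have [u uE] := poly_split0 H`_i; exists u; rewrite uE.
    have := congr1 (fun p : P => p`_i) H0; rewrite coef_map coef0 /= /horner_eval => ->.
    by rewrite add0r.
  exists (\poly_(i < size H) (if insub i is Some j then u j else 0)).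
  rewrite MH exprSr polyCM -mulrA; congr (_ * _); apply/polyP => i.
  rewrite coefCM coef_poly; case: ltnP => iH; last by rewrite mulr0 nth_default.
  by rewrite insubT /= -[RHS]mulrC -(uE (Ordinal iH)).
apply/polyP => i; rewrite coef0; apply/eqP; apply: contraT => Mi0.
have [H MH] := Mk (size M`_i).
have := congr1 (fun M : {poly P} => M`_i) MH; rewrite coefCM => E.
have XM : ('X^(size M`_i) : P) %| M`_i by rewrite {2}E dvdp_mulr.
by have := dvdp_leq Mi0 XM; rewrite size_polyXn ltnn.
Qed.

Lemma dvdp_prod_XsubC d (s : seq K) (p : P) : uniq s ->
  (forall x, x \in s -> ('X - x%:P) ^+ d %| p) -> \prod_(x <- s) ('X - x%:P) ^+ d %| p.
Proof.
elim: s => [|x s IH]; first by rewrite big_nil dvd1p.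
rewrite big_cons /= => /andP[xs us] sp; rewrite Gauss_dvdp.
  rewrite sp ?mem_head //= IH // => y ys; apply: sp.
  by rewrite inE ys orbT.
apply: coprimep_expl; rewrite coprimep_sym coprimep_XsubC /root horner_prod prodf_seq_neq0.
apply/allP => y ys /=; rewrite horner_exp expf_neq0 // hornerXsubC subr_eq0.
by apply: contraNneq xs => ->.
Qed.

Lemma dvdp_base_roots d (p : P) : (forall i, ('X - (base_root i)%:P) ^+ d %| p) ->
  \prod_i ('X - (base_root i)%:P) ^+ d %| p.
Proof.
move=> pr; rewrite -big_enum -(big_map base_root xpredT (fun x => ('X - x%:P) ^+ d)).
apply: dvdp_prod_XsubC => [|x /mapP[i _ ->] //].
by rewrite (map_inj_uniq base_root_inj) enum_uniq.
Qed.

Lemma size_base_roots d : size (\prod_i ('X - (base_root i)%:P) ^+ d) = (7 * d).+1.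
Proof.
rewrite prodrXl; set q := \prod_i _.
have qm : q \is monic by apply: monic_prod => i _; apply: monicXsubC.
have q0 : (0 < size (q ^+ d))%N by rewrite size_poly_gt0 monic_neq0 ?monic_exp.
rewrite -(prednK q0) size_exp /q -big_enum.
by rewrite size_prod_XsubC size_enum_ord.
Qed.

Lemma poly_eq0_base_roots d (p : P) : (size p <= 7 * d)%N ->
  (forall i, ('X - (base_root i)%:P) ^+ d %| p) -> p = 0.
Proof.
move=> sp /dvdp_base_roots pr; apply/eqP; apply: contraT => pn0.
by have := leq_trans (dvdp_leq pn0 pr) sp; rewrite size_base_roots ltnn.
Qed.

Lemma size_map_poly_leq (R S : nzRingType) (f : {rmorphism R -> S}) (p : {poly R}) :
  (size (map_poly f p) <= size p)%N.
Proof.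
apply/leq_sizeP => j jp; rewrite coef_map.
by rewrite nth_default // raddf0.
Qed.

Lemma size_div_Xn k (H : {poly P}) : (size H <= size (('X^k)%:P * H)%R)%N.
Proof.
apply/leq_sizeP => j jH; have := nth_default 0 jH; rewrite coefCM => /eqP.
by rewrite mulf_eq0 (negPf (monic_neq0 (monicXn _ _))) => /eqP.
Qed.

(** Every point is on some line through the base form, at parameter 1. *)
Lemma base_line_eq0 (B : {poly D}) :
  (forall y, map_poly (mmap polyC (base_line y)) B = 0) -> B = 0.
Proof.
move=> B0; apply/polyP => i; rewrite coef0; apply: mpoly_vanish => v.
pose y : ext K 7 3 := \row_s (v s - base_form 0 s).
have := congr1 (fun p : {poly P} => p`_i) (B0 y); rewrite coef_map coef0 /=.
move=> /(congr1 (horner_eval 1)); rewrite /horner_eval horner_mmap horner0 => <-.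
by apply: meval_eq => s; rewrite /base_line /y mxE hornerD hornerM hornerX !hornerC mul1r addrC subrK.
Qed.

(** Near the base line, a line in the direction of the Fano form meets the cone in
   seven points, more than the number of roots that a nonzero B can have. *)
Lemma vanish_cone_deg6 (B : {poly D}) : vanish_cone B -> (size B <= 7)%N -> B = 0.
Proof.
move=> JB sB; apply: base_line_eq0 => y; apply: poly2_eq0 => k H BH.
apply: (@poly_eq0_base_roots 1).
  apply: leq_trans (size_map_poly_leq _ _) _; apply: leq_trans (size_div_Xn k _) _.
  by rewrite -BH; apply: leq_trans (size_map_poly_leq _ _) sB.
by move=> i; rewrite expr1 dvdp_XsubCl; apply/rootP; apply: vanish_cone_root BH i.
Qed.

End Transversality.

(** * Approximate cube roots *)

Section ApproximateCubeRoot.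

Variable R : comNzRingType.
Implicit Types p q : {poly R}.

Lemma monic_coef p m : p \is monic -> size p = m.+1 -> p`_m = 1.
Proof. by move=> /monicP pm sp; rewrite -pm lead_coefE sp. Qed.

Lemma monic_subXn p m : p \is monic -> size p = m.+1 -> (size (p - 'X^m)%R <= m)%N.
Proof.
move=> pm sp; apply/leq_sizeP => j; rewrite coefB coefXn leq_eqVlt => /predU1P[<-|mj].
  by rewrite eqxx (monic_coef pm sp) subrr.
by rewrite nth_default ?sp // gtn_eqF // subrr.
Qed.

Lemma size_sub_le p q m : (size p <= m)%N -> (size q <= m)%N -> (size (p - q)%R <= m)%N.
Proof.
by move=> pm qm; apply: leq_trans (size_polyD _ _) _; rewrite size_polyN geq_max pm.
Qed.

Lemma monicX_size p d k : p \is monic -> size p = d.+1 -> size (p ^+ k) = (k * d).+1.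
Proof.
move=> pm sp; elim: k => [|k IH]; first by rewrite expr0 size_poly1.
by rewrite exprS size_monicM ?monic_neq0 ?monic_exp // sp IH addSn /= addnS mulSn.
Qed.

Lemma size_mul_le p q m n : (size p <= m.+1)%N -> (size q <= n.+1)%N ->
  (size (p * q)%R <= (m + n).+1)%N.
Proof.
move=> pm qn; apply: leq_trans (size_polyMleq _ _) _.
have : (size p + size q <= m.+1 + n.+1)%N by rewrite leq_add.
by rewrite addSn addnS; case: (_ + _)%N => [|k] //=; rewrite ltnS.
Qed.

(** The coefficients of the cube root of a monic polynomial of degree 3d are
   determined successively by its d highest coefficients. *)
Lemma cube_root_approx (t : R) (f : {poly R}) d : 3%:R * t = 1 ->
  f \is monic -> size f = (3 * d).+1 ->
  exists p, [/\ p \is monic, size p = d.+1 & (size (f - p ^+ 3)%R <= 2 * d)%N].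
Proof.
move=> t3 fm sf.
suff H j : (j <= d)%N -> exists p, [/\ p \is monic, size p = d.+1 & (size (f - p ^+ 3)%R <= 3 * d - j)%N].
  by have [p [pm sp pf]] := H d (leqnn d); exists p; split=> //; rewrite (leq_trans pf) //; lia.
elim: j => [_|j IH jd].
  exists 'X^d; rewrite monicXn size_polyXn -exprM subn0 [(d * 3)%N]mulnC; split=> //.
  exact: monic_subXn.
have [p [pm sp pf]] := IH (ltnW jd).
pose e := (3 * d - j.+1)%N; pose l := (e - 2 * d)%N.
have lE : l = (d - j.+1)%N by rewrite /l /e; lia.
set r := f - p ^+ 3 in pf; pose c := r`_e.
pose b : {poly R} := (t * c)%:P * 'X^l.
have sX (a : R) : (size (a%:P * 'X^l)%R <= l.+1)%N.
  by rewrite -[l]add0n; apply: size_mul_le; rewrite ?size_polyXn ?size_polyC_leq1.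
have sb : (size b <= l.+1)%N by apply: sX.
have sbd : (size b <= d)%N by rewrite (leq_trans sb) // lE; lia.
have spb : size (p + b) = d.+1 by rewrite size_polyDl sp.
exists (p + b); split=> //.
  by apply/monicP; rewrite lead_coefDl ?sp // (monicP pm).
have e3 : (3%:R : {poly R}) * b = c%:P * 'X^l.
  by rewrite /b mulrA -polyC_natr -polyCM mulrA t3 mul1r.
have -> : f - (p + b) ^+ 3 = (r - c%:P * 'X^e) - c%:P * ((p ^+ 2 - 'X^(2 * d)) * 'X^l)
    - (p * (c%:P * 'X^l) * b + b ^+ 3).
  have eE : e = (2 * d + l)%N by rewrite /l /e; lia.
  have -> : c%:P * 'X^e = 'X^(2 * d) * (3%:R * b) by rewrite e3 eE exprD; ring.
  have -> : c%:P * ((p ^+ 2 - 'X^(2 * d)) * 'X^l) = (p ^+ 2 - 'X^(2 * d)) * (3%:R * b).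
    by rewrite e3; ring.
  by rewrite -e3 /r; ring.
rewrite -/e; apply: size_sub_le; first apply: size_sub_le.
- apply/leq_sizeP => i; rewrite coefB coefCM coefXn leq_eqVlt => /predU1P[<-|ei].
    by rewrite eqxx mulr1 subrr.
  rewrite gtn_eqF // mulr0 subr0 nth_default // (leq_trans pf) //; lia.
- have s2 : (size (p ^+ 2 - 'X^(2 * d))%R <= 2 * d)%N.
    by apply: monic_subXn; rewrite ?monic_exp // (monicX_size 2 pm sp).
  have s3 : (size (p ^+ 2 - 'X^(2 * d))%R <= (2 * d).-1.+1)%N by rewrite (leq_trans s2) ?leqSpred.
  have s4 : (size ('X^l : {poly R}) <= l.+1)%N by rewrite size_polyXn.
  have s5 := size_mul_le (size_polyC_leq1 c) (size_mul_le s3 s4).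
  by apply: leq_trans s5 _; lia.
- have sp1 : (size p <= d.+1)%N by rewrite sp.
  have s1 := size_mul_le (size_mul_le sp1 (sX c)) sb.
  have s2 := size_mul_le (size_mul_le sb sb) sb.
  apply: leq_trans (size_polyD _ _) _; rewrite geq_max; apply/andP; split.
    by apply: leq_trans s1 _; lia.
  by rewrite exprSr expr2; apply: leq_trans s2 _; lia.
Qed.

End ApproximateCubeRoot.

(** * Multiple roots and uniqueness of cube roots *)

Section UnivariateRoots.

Variable K : numClosedFieldType.
Local Notation P := {poly K}.
Implicit Types p q : P.

(** In the factorization of p^3 - q^3 the quadratic factor has degree exactly 2d,
   its leading coefficient being 3. *)
Lemma monic_cube_inj d p q : p \is monic -> q \is monic -> size p = d.+1 -> size q = d.+1 ->
  (size (p ^+ 3 - q ^+ 3)%R <= 2 * d)%N -> p = q.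
Proof.
move=> pm qm sp sq; have -> : p ^+ 3 - q ^+ 3 = (p - q) * (p ^+ 2 + p * q + q ^+ 2) by ring.
set w := p ^+ 2 + _ + _; move=> sw; apply/eqP; rewrite -subr_eq0; apply: contraLR sw => pq.
have w2d : w`_(2 * d) = 3%:R.
  have pqm : p * q \is monic by rewrite monicMl.
  rewrite /w !coefD (monic_coef (monic_exp 2 pm) (monicX_size 2 pm sp)).
  rewrite (monic_coef (monic_exp 2 qm) (monicX_size 2 qm sq)) (monic_coef pqm) //.
    by ring.
  by rewrite size_monicM ?monic_neq0 // sp sq; lia.
have sw : (2 * d < size w)%N.
  by rewrite ltnNge; apply/negP => /(nth_default 0)/eqP; rewrite w2d pnatr_eq0.
have w0 : w != 0 by rewrite -size_poly_gt0 (leq_trans _ sw).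
have s1 : (0 < size (p - q)%R)%N by rewrite size_poly_gt0.
rewrite size_mul // -ltnNge; move: s1 sw; move: (size _) (size _) => m1 m2; lia.
Qed.

(** The second hypothesis excludes the cube roots of a ^+ 3 that differ from a by
   a nontrivial cube root of unity, without requiring A to contain one. *)
Lemma cube_inj (A : idomainType) (a b : A) :
  a ^+ 3 = b ^+ 3 -> a ^+ 2 + a * b + b ^+ 2 != 0 -> a = b.
Proof.
move=> ab /negPf ab0; apply/eqP; rewrite -subr_eq0.
have /eqP : (a - b) * (a ^+ 2 + a * b + b ^+ 2) = 0 by rewrite -(subrr (b ^+ 3)) -{1}ab; ring.
by rewrite mulf_eq0 ab0 orbF.
Qed.

Lemma double_root p x : p.[x] = 0 -> p^`().[x] = 0 -> ('X - x%:P) ^+ 2 %| p.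
Proof.
move=> /eqP/factor_theorem[q ->]; rewrite derivM derivXsubC mulr1 !hornerE subrr mulr0 add0r.
by move=> /eqP/factor_theorem[u ->]; rewrite -mulrA -expr2 dvdp_mull.
Qed.

Lemma triple_root p x : p.[x] = 0 -> p^`().[x] = 0 -> p^`()^`().[x] = 0 ->
  ('X - x%:P) ^+ 3 %| p.
Proof.
move=> p0 p1; have /dvdpP[q ->] := double_root p0 p1.
rewrite !(derivM, derivD, derivXsubC, deriv_exp, derivE) /= !hornerE subrr.
rewrite !(mulr0, mul0r, expr0n, addr0, add0r, mulr1, mul1r, expr1) /= => E.
have /eqP : 2 * q.[x] = 0 by rewrite -[RHS]E; ring.
rewrite mulf_eq0 pnatr_eq0 => /factor_theorem[u ->].
by rewrite -!mulrA -!expr2 -exprS dvdp_mull.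
Qed.

Lemma dvdp_cube_derivs p x : ('X - x%:P) ^+ 3 %| p ->
  [/\ p.[x] = 0, p^`().[x] = 0 & p^`()^`().[x] = 0].
Proof.
case/dvdpP => q ->.
have -> : q * ('X - x%:P) ^+ 3 = ('X - x%:P) * (('X - x%:P) * (('X - x%:P) * q)) by ring.
have val0 r : (('X - x%:P) * r).[x] = 0 by rewrite hornerM hornerXsubC subrr mul0r.
have val1 r : (('X - x%:P) * r)^`().[x] = r.[x].
  by rewrite derivM derivXsubC mul1r hornerD val0 addr0.
have val2 r : (('X - x%:P) * r)^`()^`().[x] = r^`().[x] *+ 2.
  by rewrite derivM derivXsubC mul1r derivD hornerD val1 mulr2n.
by split; rewrite ?val2 ?val1 val0 ?mul0rn.
Qed.

End UnivariateRoots.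

(** * Restriction to lines in the direction of the Fano form *)

Section Lines.

Variable K : numClosedFieldType.
Local Notation N := #|{: ksub 7 3}|.
Local Notation D := {mpoly K[N]}.
Local Notation p0 := (fano_form K).

(** The restriction of Q to the line y + X p0, with y generic. *)
Definition along_fano : D -> {poly D} :=
  mmap (polyC \o @mpolyC N K) (fun s => ('X_s)%:P + ((p0 0 s)%:MP)%:P * 'X).

HB.instance Definition _ := GRing.RMorphism.on along_fano.

Lemma along_fano_eval (Q : D) (y : ext K 7 3) x :
  (map_poly (meval (fun s => y 0 s)) (along_fano Q)).[x] = peval Q (y + x *: p0).
Proof.
rewrite /along_fano /peval; elim/mpolyind: Q => [|c m Q _ _ IH].
  by rewrite mmap0 meval0 rmorph0 horner0.
rewrite mmapD mevalD mmapZ mevalZ rmorphD hornerD IH rmorphM hornerM; congr (_ * _ + _).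
  by rewrite /= map_polyC hornerC /= mevalC.
rewrite mmapX mevalX /mmap1 rmorph_prod horner_prod; apply: eq_bigr => s _.
rewrite rmorphXn horner_exp; congr (_ ^+ _).
rewrite rmorphD rmorphM /= !map_polyC map_polyX /= !hornerE mevalXU mevalC !mxE.
by rewrite mulrC.
Qed.

Lemma along_fano0 (Q : D) : (along_fano Q).[0] = Q.
Proof.
rewrite /along_fano; elim/mpolyind: Q => [|c m Q _ _ IH]; first by rewrite mmap0 horner0.
rewrite mmapD mmapZ hornerD IH hornerM; congr (_ + _); rewrite mmapX.
rewrite -mul_mpolyC; congr (_ * _); first exact: hornerC.
rewrite /mmap1 horner_prod [RHS]mpolyXE_id; apply: eq_bigr => s _.
by rewrite horner_exp hornerD hornerM hornerX !hornerC mulr0 addr0.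
Qed.

(** The Gram matrix of the generic 3-form. *)
Definition phi_generic : 'M[D]_#|{: ksub 7 2}| :=
  \matrix_(a, b) \sum_s (phi_gram (delta_mx 0 s) a b)%:MP * 'X_s.

Definition phi_det : D := \det phi_generic.

Lemma phi_genericE (w : ext K 7 3) : map_mx (meval (fun s => w 0 s)) phi_generic = phi_gram w.
Proof.
rewrite [w in RHS]row_sum_delta phi_gram_sum; apply/matrixP => a b.
rewrite !mxE summxE rmorph_sum; apply: eq_bigr => s _.
by rewrite rmorphM /= mevalC mevalXU phi_gramZ [RHS]mxE [LHS]mulrC.
Qed.

Lemma phi_detE (w : ext K 7 3) : peval phi_det w = \det (phi_gram w).
Proof. by rewrite /peval /phi_det -det_map_mx phi_genericE. Qed.

Local Notation F0 := (\det (phi_gram p0)).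

(** Since det (M + X M0) = det M0 * det (X + M0^-1 M), the determinant along the
   lines y + X p0 is, up to the constant det M0, a characteristic polynomial;
   this gives at once its degree and that it is monic. *)
Definition phi_char : {poly D} :=
  char_poly (- map_mx (@mpolyC N K) (invmx (phi_gram p0)) *m phi_generic).

Lemma phi_char_monic : phi_char \is monic. Proof. exact: char_poly_monic. Qed.

Lemma size_phi_char : size phi_char = 22.
Proof. by rewrite size_char_poly card_ksub. Qed.

Lemma along_phi_det : along_fano phi_det = (F0%:MP)%:P * phi_char.
Proof.
have pu : phi_gram p0 \in unitmx by rewrite unitmxE unitfE det_phi_fano.
pose Bm := map_mx (@mpolyC N K) (phi_gram p0).
pose Cm := map_mx (@mpolyC N K) (invmx (phi_gram p0)).
have BC : Bm *m Cm = 1%:M by rewrite /Bm /Cm -map_mxM mulmxV // map_mx1.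
have -> : (F0%:MP)%:P = \det (map_mx polyC Bm) by rewrite !det_map_mx.
rewrite /phi_char /char_poly -det_mulmx.
have -> : map_mx polyC Bm *m char_poly_mx (- Cm *m phi_generic) =
    'X *: map_mx polyC Bm + map_mx polyC phi_generic.
  rewrite /char_poly_mx mulmxBr mul_mx_scalar -map_mxM; congr (_ + _).
  by rewrite mulNmx mulmxN mulmxA BC mul1mx map_mxN opprK.
rewrite /phi_det -[along_fano _](det_map_mx along_fano); congr (\det _).
apply/matrixP => a b.
pose c (s : 'I_N) : K := phi_gram (delta_mx 0 s : ext K 7 3) a b.
have gE : phi_generic a b = \sum_s (c s)%:MP * 'X_s by rewrite mxE.
have p0E : phi_gram p0 a b = \sum_s p0 0 s * c s.
  rewrite {1}[p0]row_sum_delta phi_gram_sum summxE; apply: eq_bigr => s _.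
  by rewrite phi_gramZ mxE.
transitivity (along_fano (phi_generic a b)); first by rewrite mxE.
have -> : ('X *: map_mx polyC Bm + map_mx polyC phi_generic) a b =
    'X * (phi_gram p0 a b)%:MP%:P + (phi_generic a b)%:P.
  by rewrite mxE mxE; congr (_ * _ + _); rewrite mxE // mxE.
rewrite gE p0E !rmorph_sum mulr_sumr -big_split; apply: eq_bigr => s _ /=.
rewrite rmorphM /= /along_fano mmapC mmapX mmap1U /=.
rewrite !rmorphM /=.
ring.
Qed.

End Lines.

(** * The determinant along these lines is a cube *)

Section CubeRoot.

Variable K : numClosedFieldType.
Local Notation P := {poly K}.
Local Notation N := #|{: ksub 7 3}|.
Local Notation D := {mpoly K[N]}.
Local Notation p0 := (fano_form K).
Local Notation at_form y := (meval (fun s => (y : 'rV[K]_N) 0 s)).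

(** On a pencil through a point of the cone the determinant is divisible by 'X^3;
   translate the pencil by x. *)
Lemma phi_char_cone (y : ext K 7 3) x : cone (y + x *: p0) ->
  ('X - x%:P) ^+ 3 %| map_poly (at_form y) (phi_char K).
Proof.
move=> cy; set s := y + x *: p0 in cy.
pose G := \det (map_mx polyC (phi_gram s) + 'X *: map_mx polyC (phi_gram p0)).
have GE t : G.[t] = \det (phi_gram (s + t *: p0)).
  rewrite /G -[_.[t]]/(horner_eval t _) -det_map_mx phi_gramD phi_gramZ; congr (\det _).
  move: (phi_gram s) (phi_gram p0) => A B; apply/matrixP => a b.
  by rewrite !mxE /= /horner_eval hornerD hornerM hornerX !hornerC.
have F0 := det_phi_fano K.
have fG : (\det (phi_gram p0))%:P * map_poly (at_form y) (phi_char K) = G \Po ('X - x%:P).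
  apply/eqP; rewrite -subr_eq0; apply/eqP/poly_vanish => t.
  rewrite hornerD hornerN horner_comp GE hornerM hornerC hornerXsubC.
  have := along_fano_eval (phi_det K) y t; rewrite along_phi_det phi_detE.
  rewrite rmorphM hornerM /= map_polyC hornerC /= mevalC => ->.
  by rewrite /s -addrA -scalerDl subrKC subrr.
have : 'X^3 %| G by apply: det_phi_cone_dvd.
move=> /(dvdp_comp_poly ('X - x%:P)); rewrite comp_Xn_poly -fG mul_polyC.
by rewrite dvdpZr.
Qed.

Lemma vanish_cone_phi_char :
  [/\ vanish_cone (phi_char K), vanish_cone (phi_char K)^`() & vanish_cone (phi_char K)^`()^`()].
Proof.
split=> y x /phi_char_cone/dvdp_cube_derivs[f0 f1 f2]; by rewrite -?deriv_map.
Qed.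

Lemma map_poly_comp_eval (y : ext K 7 3) (B : {poly D}) :
  map_poly (horner_eval 0) (map_poly (mmap polyC (base_line y)) B) =
  map_poly (at_form (base_form K)) B.
Proof.
apply/polyP => i; rewrite !coef_map /= /horner_eval horner_mmap; apply: meval_eq => s.
by rewrite /base_line hornerD hornerM hornerX !hornerC mul0r addr0.
Qed.

(** Seven triple roots exhaust the degree 21. *)
Lemma phi_char_base :
  map_poly (at_form (base_form K)) (phi_char K) = (\prod_i ('X - (base_root K i)%:P)) ^+ 3.
Proof.
have [f0 f1 f2] := vanish_cone_phi_char.
set f := map_poly _ _; have fm : f \is monic by rewrite monic_map ?phi_char_monic.
have sf : size f = 22.
  by rewrite size_map_poly_id0 ?size_phi_char // (monicP (phi_char_monic K)) rmorph1 oner_eq0.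
have val0 (B : {poly D}) i : vanish_cone B -> (map_poly (at_form (base_form K)) B).[base_root K i] = 0.
  by apply; rewrite -base_fano; apply: (@cone_fano _ _ i); apply: base_fano_eq0.
have : \prod_i ('X - (base_root K i)%:P) ^+ 3 %| f.
  apply: dvdp_base_roots => i; apply: triple_root; rewrite ?deriv_map; exact: val0.
move=> dv; have wm : \prod_i ('X - (base_root K i)%:P) ^+ 3 \is monic.
  by apply: monic_prod => i _; apply/monic_exp/monicXsubC.
rewrite -prodrXl; apply/esym/eqP; rewrite -eqp_monic //.
by have := dvdp_size_eqp dv; rewrite size_base_roots sf eqxx => <-.
Qed.

(** Let H0 be the remainder of the approximate cube root p, restricted to a line
   through the base form, divided by a power of the parameter and
   evaluated at the base form.  There p becomes W, the product of the seven
   linear factors, and G becomes W H0' - 3 W' H0.  At a root of W, which is simple,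
   the vanishing of G gives H0 = 0, and then the vanishing of
   G' = -2 W' H0' + W H0'' - 3 W'' H0 gives H0' = 0.  The degree of H0, less than
   14, does not allow seven double roots. *)
Lemma phi_char_cube : exists p : {poly D}, [/\ p \is monic, size p = 8 & phi_char K = p ^+ 3].
Proof.
have t3 : 3%:R * (3%:R^-1)%:MP = 1 :> D.
  by rewrite -mpolyC_nat -mpolyCM divff ?pnatr_eq0 // mpolyC1.
have [p [pm sp pR]] := cube_root_approx t3 (phi_char_monic K) (size_phi_char K : _ = (3 * 7).+1).
exists p; split=> //; apply/eqP; rewrite -subr_eq0; apply/eqP.
set R := _ - _ in pR *; set f := phi_char K in R pR *.
have [f0 f1 f2] := vanish_cone_phi_char; rewrite -/f in f0 f1 f2.
pose G := p * f^`() - 3%:R * p^`() * f.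
(* The cubic terms p^3 of f cancel in G. *)
have GR : G = p * R^`() - 3%:R * p^`() * R.
  rewrite /G /R derivB !exprS expr0 mulr1 !derivM; move: (p^`()) (f^`()) => p' f'; ring.
have JG : vanish_cone G.
  move=> y x cy; rewrite /G rmorphB !rmorphM hornerD hornerN !hornerM.
  by rewrite f0 // f1 // !mulr0 subrr.
have JG' : vanish_cone G^`().
  move=> y x cy; rewrite /G derivB !derivM -polyC_natr derivC mul0r add0r.
  rewrite rmorphB !rmorphD !rmorphM hornerD hornerN !hornerD !hornerM.
  by rewrite f0 // f1 // f2 // !mulr0 !addr0 subrr.
apply: base_line_eq0 => y; apply: poly2_eq0 => k H RH.
pose W := \prod_i ('X - (base_root K i)%:P).
have W0 i : W.[base_root K i] = 0.
  by rewrite /W (bigD1 i) //= hornerM hornerXsubC subrr mul0r.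
have W1 i : W^`().[base_root K i] != 0.
  rewrite /W (bigD1 i) //= derivM derivXsubC mul1r hornerD hornerM hornerXsubC subrr mul0r addr0.
  rewrite horner_prod; apply/prodf_neq0 => j ji; rewrite hornerXsubC subr_eq0.
  by rewrite (inj_eq (@base_root_inj K)) eq_sym.
pose atp := map_poly (mmap polyC (base_line y)) p.
(* The cubes of the two sides differ by the value of R, of degree less
   than 14. *)
have pW : map_poly (horner_eval 0) atp = W.
  rewrite /atp map_poly_comp_eval; apply: (@monic_cube_inj K 7).
  - by rewrite monic_map.
  - by apply: monic_prod => i _; apply: monicXsubC.
  - by rewrite size_map_poly_id0 // (monicP pm) rmorph1 oner_eq0.
  - by have := size_base_roots K 1; rewrite -/W muln1.
  rewrite -[W ^+ 3]phi_char_base -rmorphXn -rmorphB /= -opprB rmorphN size_polyN.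
  exact: leq_trans (size_map_poly_leq _ _) pR.
pose H0 := map_poly (horner_eval 0) H.
pose HG := atp * H^`() - 3%:R * atp^`() * H.
have GH : map_poly (mmap polyC (base_line y)) G = ('X^k)%:P * HG.
  rewrite GR rmorphB !rmorphM rmorph_nat /= -!deriv_map RH derivM derivC mul0r add0r -/atp.
  by rewrite /HG; ring.
have GH' : map_poly (mmap polyC (base_line y)) G^`() = ('X^k)%:P * HG^`().
  by rewrite -deriv_map GH derivM derivC mul0r add0r.
have HG0 : map_poly (horner_eval 0) HG = W * H0^`() - 3%:R * W^`() * H0.
  by rewrite /HG rmorphB !rmorphM rmorph_nat /= -!deriv_map pW.
have root0 i : H0.[base_root K i] = 0.
  have := vanish_cone_root JG GH i; rewrite HG0 hornerD hornerN !hornerM W0 mul0r add0r.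
  move/eqP; rewrite oppr_eq0 !mulf_eq0 (negPf (W1 i)) orbF => /orP[|/eqP //].
  by rewrite -polyC_natr hornerC pnatr_eq0.
have root1 i : H0^`().[base_root K i] = 0.
  have := vanish_cone_root JG' GH' i; rewrite -deriv_map HG0 derivB !derivM -polyC_natr derivC mul0r add0r.
  rewrite !(hornerD, hornerN, hornerM) W0 root0 hornerC => E.
  have /eqP : - 2%:R * W^`().[base_root K i] * H0^`().[base_root K i] = 0.
    by rewrite -[RHS]E; ring.
  by rewrite !mulf_eq0 oppr_eq0 pnatr_eq0 (negPf (W1 i)) /= => /eqP.
apply: (@poly_eq0_base_roots K 2) => [|i]; last exact: double_root.
apply: leq_trans (size_map_poly_leq _ _) _; apply: leq_trans (size_div_Xn k _) _.
by rewrite -RH; apply: leq_trans (size_map_poly_leq _ _) pR.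
Qed.

End CubeRoot.

(** * Homogeneity *)

Section Homogeneity.

Variables (K : numClosedFieldType) (N : nat).
Local Notation D := {mpoly K[N]}.

Lemma mpoly_vanish_row (Q : D) : (forall w, peval Q w = 0) -> Q = 0.
Proof.
move=> Q0; apply: mpoly_vanish => v; rewrite -(Q0 (\row_s v s)).
by apply: meval_eq => s; rewrite mxE.
Qed.

(** As polynomials in t, Q(t w) and t^d Q(w) agree, so the homogeneous component
   of Q of each degree other than d vanishes everywhere. *)
Lemma homog_of_scale (Q : D) d :
  (forall t (w : 'rV[K]_N), peval Q (t *: w) = t ^+ d * peval Q w) -> Q \is d.-homog.
Proof.
move=> Qt; apply/dhomogP => m mQ; apply/eqP; apply: contraT => md.
pose S : {poly D} := \sum_(m' <- msupp Q) (Q@_m' *: 'X_[m'])%:P * 'X^(mdeg m').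
have SE (w : 'rV[K]_N) : map_poly (meval (fun s => w 0 s)) S = (peval Q w)%:P * 'X^d.
  apply/eqP; rewrite -subr_eq0; apply/eqP/poly_vanish => t.
  rewrite hornerD hornerN hornerM hornerC hornerXn [_ * t ^+ d]mulrC -Qt /S rmorph_sum horner_sum.
  rewrite [peval _ _]mevalE -sumrB big1 // => m' _.
  rewrite rmorphM /= map_polyC map_polyXn hornerM hornerC hornerXn /= mevalZ mevalX.
  rewrite mdegE -prodrXr -mulrA -big_split /=; apply/eqP; rewrite subr_eq0; apply/eqP.
  by congr (_ * _); apply: eq_bigr => s _; rewrite mxE exprMn mulrC.
(* The coefficient of t ^+ mdeg m in Q(t w), as a polynomial in w. *)
have Sm : S`_(mdeg m) = 0.
  apply: mpoly_vanish_row => w; have := congr1 (fun p : {poly K} => p`_(mdeg m)) (SE w).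
  by rewrite coef_map /= coefCM coefXn (negPf md) mulr0.
have := congr1 (mcoeff m) Sm; rewrite coef_sum mcoeff0 raddf_sum /=.
rewrite (bigD1_seq m) ?msupp_uniq //= coefCM coefXn eqxx mulr1 mcoeffZ mcoeffX eqxx mulr1.
rewrite big1 ?addr0 => [/eqP|m' m'm]; first by rewrite mcoeff_eq0 mQ.
rewrite coefCM coefXn; case: (_ == _); rewrite ?mulr1 ?mulr0 ?mcoeff0 //.
by rewrite mcoeffZ mcoeffX (negPf m'm) mulr0.
Qed.

End Homogeneity.

(** * The polynomial of degree seven *)

Section Equation.

Variable K : numClosedFieldType.
Local Notation P := {poly K}.
Local Notation N := #|{: ksub 7 3}|.
Local Notation D := {mpoly K[N]}.
Local Notation p0 := (fano_form K).

(** The restriction of Q to the generic line in the direction of the Fano form is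
   the constant a times a monic polynomial p of degree 7 in the position. *)
Definition equation (Q : D) (a : K) (p : {poly D}) :=
  [/\ a != 0, p \is monic, size p = 8, along_fano Q = (a%:MP)%:P * p
    & forall w, \det (phi_gram w) = 2 * peval Q w ^+ 3].

(** Both sides of along_fano Q = a p have the same cube, by the choice of a, and
   they agree at X = 0; so they are equal by uniqueness of cube roots. *)
Lemma ex_equation : exists Q a p, equation Q a p.
Proof.
have [p [pm sp pE]] := phi_char_cube K.
have F0 := det_phi_fano K; set F := \det (phi_gram p0) in F0.
pose a := 3.-root (F / 2); have a3 : a ^+ 3 = F / 2 by rewrite rootCK.
have two0 : 2 != 0 :> K by rewrite pnatr_eq0.
have a0 : a != 0 by rewrite rootC_eq0 // mulf_neq0 ?invr_eq0.
pose Q : D := a *: p.[0].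
have phiE : phi_det K = F *: p.[0] ^+ 3.
  by rewrite -[LHS]along_fano0 along_phi_det pE hornerM hornerC horner_exp mul_mpolyC.
have detE w : \det (phi_gram w) = 2 * peval Q w ^+ 3.
  rewrite -phi_detE phiE /peval !mevalZ exprMn a3 mulrA [2 * _]mulrC divfK //.
  by rewrite rmorphXn.
have Q0 : Q != 0.
  apply: contraNneq F0 => Q0; rewrite /F detE Q0 /peval meval0 expr0n mulr0 //.
exists Q, a, p; split=> //.
apply: cube_inj; last first.
  apply: contraNneq Q0 => /(congr1 (horner^~ 0)).
  rewrite horner0 !(hornerD, hornerM) along_fano0 !hornerC mul_mpolyC -/Q => /eqP.
  have -> : Q * Q + Q * Q + Q * Q = 3%:R * Q ^+ 2 by ring.
  by rewrite mulf_eq0 expf_eq0 -mpolyC_nat mpolyC_eq pnatr_eq0.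
rewrite -rmorphXn exprMn -!rmorphXn /= a3.
have -> : Q ^+ 3 = (2^-1)%:MP * phi_det K.
  by rewrite phiE /Q exprZn a3 mul_mpolyC scalerA mulrC.
rewrite rmorphM /= along_phi_det -pE mulrA; congr (_ * _).
by rewrite /along_fano mmapC /= -polyCM -mpolyCM mulrC.
Qed.

End Equation.

(** * The ideal of the cone *)

Section EquationTheory.

Variable K : numClosedFieldType.
Local Notation P := {poly K}.
Local Notation N := #|{: ksub 7 3}|.
Local Notation D := {mpoly K[N]}.
Local Notation p0 := (fano_form K).
Variables (Q : D) (a : K) (p : {poly D}).
Hypothesis eqQ : equation Q a p.

Lemma equation_cone w : cone w -> peval Q w = 0.
Proof.
case: eqQ => _ _ _ _ detE cw.
have : ('X : P) %| \det (map_mx polyC (phi_gram w) + 'X *: map_mx polyC (phi_gram 0)).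
  by apply: dvdp_trans (det_phi_cone_dvd 0 cw); rewrite dvdp_exp.
rewrite (_ : ('X : P) = 'X - 0%:P); last by rewrite polyC0 subr0.
rewrite dvdp_XsubCl => /rootP; rewrite phi_gram0 map_mx0 scaler0 addr0 det_map_mx hornerC.
by rewrite detE => /eqP; rewrite mulf_eq0 pnatr_eq0 expf_eq0 => /andP[_ /eqP].
Qed.

Lemma equation_fano : peval Q p0 != 0.
Proof.
case: eqQ => _ _ _ _ detE; apply: contraNneq (det_phi_fano K) => Q0.
by rewrite detE Q0 expr0n mulr0.
Qed.

(** The cubes agree because the determinant has degree 21.  Cube roots are unique
   among polynomials in the scaling parameter that agree at 1. *)
Lemma equation_scale t w : peval Q (t *: w) = t ^+ 7 * peval Q w.
Proof.
case: eqQ => _ _ _ _ detE.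
have cubeE s : peval Q (s *: w) ^+ 3 = (s ^+ 7 * peval Q w) ^+ 3.
  apply: (mulfI (_ : 2 != 0 :> K)); first by rewrite pnatr_eq0.
  rewrite -detE phi_gramZ detZ detE exprMn -exprM mulrCA; congr (_ * (_ ^+ _ * _)).
  by rewrite card_ksub.
have [Q0|Q0] := eqVneq (peval Q w) 0.
  by move/eqP: (cubeE t); rewrite Q0 mulr0 expr0n expf_eq0 => /eqP.
pose A := mmap polyC (fun s => 'X * (w 0 s)%:P) Q.
have AE s : A.[s] = peval Q (s *: w).
  by rewrite horner_mmap; apply: meval_eq => i; rewrite mxE hornerM hornerX hornerC.
suff AB : A = 'X^7 * (peval Q w)%:P by rewrite -AE AB hornerM hornerXn hornerC.
apply: cube_inj.
  apply/eqP; rewrite -subr_eq0; apply/eqP/poly_vanish => s.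
  by rewrite hornerD hornerN !horner_exp AE cubeE hornerM hornerXn hornerC subrr.
have at1 (u v : P) : (u ^+ 2 + u * v + v ^+ 2).[1] = u.[1] ^+ 2 + u.[1] * v.[1] + v.[1] ^+ 2.
  by rewrite !hornerD !horner_exp hornerM.
have B1 : ('X^7 * (peval Q w)%:P).[1] = peval Q w.
  by rewrite hornerM hornerXn hornerC expr1n mul1r.
apply: contraNneq Q0 => /(congr1 (horner^~ 1)).
rewrite at1 B1 AE scale1r horner0 => E.
have /eqP : 3%:R * peval Q w ^+ 2 = 0 by rewrite -[RHS]E; ring.
by rewrite mulf_eq0 pnatr_eq0 expf_eq0.
Qed.

Lemma equation_homog : Q \is 7.-homog.
Proof. by apply: homog_of_scale; apply: equation_scale. Qed.

(** The remainder of the division of B, along the lines, by p has degree at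
   most 6 and vanishes on the cone. *)
Lemma equation_dvd (B : D) : (forall w, cone w -> peval B w = 0) -> exists S, B = S * Q.
Proof.
case: eqQ => a0 pm sp QE detE B0.
have p_cone : vanish_cone p.
  move=> y x cy; have := equation_cone cy; rewrite -along_fano_eval QE rmorphM hornerM /=.
  by rewrite map_polyC hornerC /= mevalC => /eqP; rewrite mulf_eq0 (negPf a0) => /eqP.
pose A := Pdiv.Ring.rdivp (along_fano B) p; pose T := Pdiv.Ring.rmodp (along_fano B) p.
have BA : along_fano B = A * p + T by apply: Pdiv.RingMonic.rdivp_eq.
have T0 : T = 0.
  apply: vanish_cone_deg6; last first.
    have := Pdiv.Ring.ltn_rmodpN0 (along_fano B) (monic_neq0 pm).
    by rewrite sp ltnS.
  move=> y x cy; have -> : T = along_fano B - A * p by rewrite BA addrC addKr.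
  rewrite rmorphB rmorphM hornerD hornerN hornerM p_cone // mulr0 subr0.
  by rewrite along_fano_eval B0.
exists (a^-1 *: A.[0]).
rewrite -[LHS]along_fano0 BA T0 addr0 hornerM -[X in _ = _ * X]along_fano0 QE hornerM hornerC.
rewrite mul_mpolyC -scalerAl -scalerAr scalerA mulVf // scale1r //.
Qed.

End EquationTheory.

(** * Polynomial characters of the general linear group *)

Section PolynomialCharacter.

Variables (K : numClosedFieldType) (n : nat).
Local Notation P := {poly K}.
Variable c : 'M[K]_n.+1 -> K.
Hypotheses (c1 : c 1%:M = 1) (cM : forall A B, c (A *m B) = c A * c B).
Hypothesis c_poly : forall A : 'M[P]_n.+1, exists r : P,
  forall e, r.[e] = c (map_mx (horner_eval e) A).

(** A substitute for continuity in limit arguments. *)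
Lemma poly_const_off0 (r : P) b : (forall e, e != 0 -> r.[e] = b) -> r.[0] = b.
Proof.
move=> rb; have : ('X * (r - b%:P)) = 0.
  apply: poly_vanish => e; rewrite hornerM hornerX hornerD hornerN hornerC.
  have [->|/rb->] := eqVneq e 0; first by rewrite mul0r.
  by rewrite subrr mulr0.
by move/eqP; rewrite mulf_eq0 polyX_eq0 subr_eq0 => /eqP ->; rewrite hornerC.
Qed.

Lemma character_conj g A : g \in unitmx -> c (g *m A *m invmx g) = c A.
Proof.
by move=> gu; rewrite !cM mulrC mulrA -cM mulVmx // c1 mul1r.
Qed.

(** Conjugation by diag(e^i) contracts a lower triangular matrix to its
   diagonal as e goes to 0. *)
Lemma character_trig A : is_trig_mx A -> c A = c (diag_mx (\row_i A i i)).
Proof.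
move=> /is_trig_mxP At; pose Ae : 'M[P]_n.+1 := \matrix_(i, j) ((A i j)%:P * 'X^(i - j)).
have [r rE] := c_poly Ae.
have -> : c A = r.[0].
  apply/esym/poly_const_off0 => e e0; rewrite rE.
  (* The matrix Ae e is the conjugate of A by diag(e^i). *)
pose d : 'rV[K]_n.+1 := \row_i e ^+ i.
  have du : diag_mx d \in unitmx.
    by rewrite unitmxE unitfE det_diag; apply/prodf_neq0 => i _; rewrite mxE expf_neq0.
  rewrite -(character_conj A du); congr c; apply: (can_inj (mulmxK du)).
  rewrite mulmxKV //; apply/matrixP => i j; rewrite mul_mx_diag mul_diag_mx !mxE.
  rewrite /horner_eval hornerM hornerC hornerXn.
  have [ij|ji] := ltnP i j; first by rewrite At // !(mul0r, mulr0).
  by rewrite -mulrA -exprD subnK // mulrC.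
rewrite rE; congr c; apply/matrixP => i j; rewrite !mxE /horner_eval hornerM hornerC hornerXn.
have [ij|ji] := ltnP i j; first by rewrite At // mul0r; case: eqP => // E; rewrite E ltnn in ij.
have [->|ne_ij] := eqVneq i j; first by rewrite subnn expr0 mulr1 mulr1n.
by rewrite expr0n subn_eq0 leqNgt ltn_neqAle ji andbT val_eqE eq_sym ne_ij mulr0.
Qed.

Definition scale_at (i : 'I_n.+1) (x : K) : 'M[K]_n.+1 :=
  diag_mx (\row_j (if j == i then x else 1)).

(** Diagonal matrices that differ by a permutation of the entries are conjugate. *)
Lemma character_scale_at i x : c (scale_at i x) = c (scale_at 0 x).
Proof.
pose s := tperm 0 i; have su : perm_mx s \in unitmx := unitmx_perm K s.
rewrite -(character_conj (scale_at 0 x) su); congr c.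
apply: (can_inj (mulmxK su)); rewrite mulmxKV // -row_permE.
have -> : scale_at i x *m perm_mx s = col_perm s (scale_at i x).
  by rewrite col_permE tpermV.
by apply/matrixP => j k; rewrite !mxE !(canF_eq (tpermK 0 i)) tpermL.
Qed.

Lemma character_diag (d : 'rV[K]_n.+1) : c (diag_mx d) = c (scale_at 0 (\prod_i d 0 i)).
Proof.
have scaleM x y : c (scale_at 0 (x * y)) = c (scale_at 0 x) * c (scale_at 0 y).
  rewrite -cM mulmx_diag; congr (c (diag_mx _)); apply/rowP => j; rewrite !mxE.
  by case: ifP; rewrite ?mulr1.
have scale1 : c (scale_at 0 1) = 1.
  by rewrite -[RHS]c1 -diag_const_mx; congr (c (diag_mx _)); apply/rowP => j; rewrite !mxE if_same.
have prodE (r : seq 'I_n.+1) :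
    c (diag_mx (\row_j \prod_(i <- r) (if j == i then d 0 i else 1))) =
    c (scale_at 0 (\prod_(i <- r) d 0 i)).
  elim: r => [|i r IH].
    rewrite big_nil scale1 -[RHS]c1 -diag_const_mx; congr (c (diag_mx _)).
    by apply/rowP => j; rewrite !mxE big_nil.
  rewrite big_cons scaleM -IH -(character_scale_at i) -cM mulmx_diag; congr (c (diag_mx _)).
  by apply/rowP => j; rewrite !mxE big_cons.
rewrite -prodE; congr (c (diag_mx _)); apply/rowP => j; rewrite mxE (bigD1 j) //=.
by rewrite eqxx big1 ?mulr1 // => i ij; rewrite eq_sym (negPf ij).
Qed.

(** A polynomial character of the general linear group factors through the
   determinant. *)
Lemma character_det g : c g = c (scale_at 0 (\det g)).
Proof.
have [//|q /unitarymx_unit qu gt] := @Schur K n.+1 g.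
have /(simmxRL qu) E : g ~_q (conjmx q g) by exact: eqxx.
rewrite -(character_conj g qu) -E character_trig // character_diag; congr (c (scale_at 0 _)).
transitivity (\det (conjmx q g)).
  by rewrite det_trig //; apply: eq_bigr => i _; rewrite mxE.
by rewrite E !det_mulmx det_inv mulrC mulrA mulVr ?mul1r // -unitmxE.
Qed.

Lemma character_SL g : \det g = 1 -> c g = 1.
Proof.
move=> g1; rewrite character_det g1 -[RHS]c1 -[1 in LHS](det1 K n.+1) -character_det.
by [].
Qed.

End PolynomialCharacter.

(** * Invariance under the special linear group *)

Section Invariance.

Variable K : numClosedFieldType.
Local Notation P := {poly K}.
Local Notation N := #|{: ksub 7 3}|.
Local Notation D := {mpoly K[N]}.
Local Notation p0 := (fano_form K).
Variables (Q : D) (a : K) (p : {poly D}).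
Hypothesis eqQ : equation Q a p.

Lemma peval_scale_row (S : D) (w : ext K 7 3) :
  exists r : P, forall t, r.[t] = peval S (t *: w).
Proof.
exists (mmap polyC (fun s => 'X * (w 0 s)%:P) S) => t.
by rewrite horner_mmap; apply: meval_eq => i; rewrite mxE hornerM hornerX hornerC.
Qed.

(** The transform of Q by g vanishes on the cone, hence is S Q for some S.
   Comparing with the action of scalars, which multiply Q and its transform by
   the same factor, S takes the same value at t y for every nonzero t, hence is
   equal to its value at 0 wherever Q is not 0. *)
Lemma equation_extmap g w :
  peval Q (extmap g w) = peval Q (extmap g p0) / peval Q p0 * peval Q w.
Proof.
pose B : D := mmap (@mpolyC N K)
  (fun t => \sum_s (extmap g (delta_mx 0 s : ext K 7 3) 0 t)%:MP * 'X_s) Q.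
have BE y : peval B y = peval Q (extmap g y).
  rewrite /peval /B; elim/mpolyind: (Q) => [|k m S _ _ IH]; first by rewrite mmap0 !meval0.
  rewrite mmapD mmapZ !mevalD mevalM mevalC mevalZ IH mmapX mevalX; congr (_ * _ + _).
  rewrite /mmap1 rmorph_prod; apply: eq_bigr => t _; rewrite rmorphXn /=; congr (_ ^+ _).
  rewrite rmorph_sum {2}[y]row_sum_delta extmap_sum summxE; apply: eq_bigr => s _.
  by rewrite rmorphM /= mevalC mevalXU extmapZ [RHS]mxE mulrC.
have [S SE] : exists S, B = S * Q.
  by apply: (equation_dvd eqQ) => y cy; rewrite BE; apply/(equation_cone eqQ)/cone_extmap.
have QS y : peval Q (extmap g y) = peval S y * peval Q y.
  by rewrite -BE SE /peval mevalM.
have S0 y : peval Q y != 0 -> peval S y = peval S 0.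
  move=> y0; have [r rE] := peval_scale_row S y.
  rewrite -[in RHS](scale0r y) -rE; apply/esym/poly_const_off0 => t t0.
  apply: (mulIf y0); apply: (mulfI (expf_neq0 7 t0)).
  rewrite rE mulrCA -(equation_scale eqQ) -QS extmapZ (equation_scale eqQ) QS.
  by rewrite mulrA.
have [y0|y0] := eqVneq (peval Q w) 0; first by rewrite QS y0 !mulr0.
have Q0 := equation_fano eqQ.
by rewrite !QS (S0 _ y0) (S0 _ Q0) mulfK.
Qed.

Lemma equation_SL g w : \det g = 1 -> peval Q (extmap g w) = peval Q w.
Proof.
move=> g1; have Q0 := equation_fano eqQ.
pose c (h : 'M[K]_7) := peval Q (extmap h p0) / peval Q p0.
have c1 : c 1%:M = 1 by rewrite /c extmap1 divff.
have cM h k : c (h *m k) = c h * c k.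
  by rewrite /c extmapM3 equation_extmap mulrA.
have c_poly (A : 'M[P]_7) : exists r : P, forall e, r.[e] = c (map_mx (horner_eval e) A).
  exists (mmap polyC (orbit_coord (fun _ => (1 : K)%:P) A) Q * ((peval Q p0)^-1)%:P) => e.
  rewrite hornerM hornerC horner_mmap; congr (_ / _); apply: meval_eq => s.
  by rewrite (horner_orbit_coord (fun _ => 1)).
by rewrite equation_extmap -[_ / _]/(c g) (character_SL c1 cM c_poly g1) mul1r.
Qed.

End Invariance.

(** * The secant variety *)

Section SecantVariety.

Variable K : numClosedFieldType.
Local Notation N := #|{: ksub 7 3}|.
Local Notation Gr := (@grassmannian K 7 3).

Lemma line_dim (w : 'rV[K]_N) : w != 0 -> \dim <[w]> == 1%N.
Proof. by rewrite dim_vline => ->. Qed.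

Lemma wedge3_free u v z : wedge3 u v z != 0 :> ext K 7 3 -> free [:: u; v; z].
Proof.
move=> w0; have vz : free [:: v; z].
  have z0 : z != 0 by apply: contraNneq w0 => ->; rewrite /wedge3 lmulv0l !lmulv0r.
  rewrite free_cons free_cons nil_free span_nil span_seq1 memv0 z0 !andbT.
  apply: contraNN w0 => /vlineP[b ->].
  by rewrite wedge3Z2 wedge3_eq23 scaler0.
rewrite free_cons vz andbT; apply: contraNN w0; rewrite span_cons span_seq1.
case/memv_addP => _ /vlineP[b ->] [_ /vlineP[b' ->] ->].
by rewrite wedge3Dl !wedge3Zl wedge3_eq12 (wedge3C12 v z z) wedge3_eq23 oppr0 !scaler0 addr0.
Qed.

Lemma wedge3_grassmannian u v z : wedge3 u v z != 0 :> ext K 7 3 ->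
  exists2 q, Gr q & wedge3 u v z \in val q.
Proof.
move=> w0; pose q : proj K N := exist _ <[wedge3 u v z]>%VS (line_dim w0).
exists q; last exact: memv_line.
exists <<[:: u; v; z]>>%VS, [tuple u; v; z]; split.
- exact/eqP/(wedge3_free w0).
- by rewrite /basis_of eqxx wedge3_free.
- by rewrite wedgev3.
Qed.

(** A 3-vector equal to zero lies on every line, so any point of the Grassmannian
   will do. *)
Lemma wedge3_in_grassmannian u v z : exists2 q, Gr q & wedge3 u v z \in val q.
Proof.
have [->|w0] := eqVneq (wedge3 u v z) 0; last exact: wedge3_grassmannian.
have e0 : wedge3 (evec K 0) (evec K 1) (evec K 2%:R) != 0 :> ext K 7 3.
  have abc : ((0%R : 'I_7) < (1%R : 'I_7) < (2%:R%R : 'I_7))%N by [].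
  rewrite wedge3_evec //; apply/negP => /eqP E.
  have := @ecoord_ebasis K 7 3 _ [set 0; 1; 2%:R] (set3_card abc).
  by rewrite E ecoord0 eqxx => /esym/eqP; rewrite oner_eq0.
have [q qG _] := wedge3_grassmannian e0.
by exists q => //; apply: mem0v.
Qed.

(** The secant variety is the closure of this set. *)
Definition secant_points (p : proj K N) : Prop :=
  exists q : 'I_3 -> proj K N,
    (forall i, Gr (q i)) /\ (val p <= \sum_(i < 3) val (q i))%VS.

Lemma cone_secant_points w : cone w -> exists2 p, secant_points p & w \in val p.
Proof.
case=> u [v [z wE]].
have /fin_all_exists2[q qG qw] m : exists2 q, Gr q & wedge3 (u m) (v m) (z m) \in val q.
  exact: wedge3_in_grassmannian.
have [w0|w0] := eqVneq w 0.
  exists (q ord0); last by rewrite w0 mem0v.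
  exists q; split=> //; rewrite (bigD1 ord0) //=; exact: addvSl.
exists (exist _ <[w]>%VS (line_dim w0)); last exact: memv_line.
by exists q; split=> //=; rewrite -memvE wE; apply: memv_sumr => m _; apply: qw.
Qed.

Lemma secant_points_cone p w : secant_points p -> w \in val p -> cone w.
Proof.
case=> q [qG pq] wp; have /memv_sumP[y yq ->] := subvP pq _ wp.
have /fin_all_exists[t tE] m : exists t : 3.-tuple 'cV[K]_7,
    y m = wedge3 (tnth t ord0) (tnth t 1) (tnth t ord_max).
  have [U [t [_ _ qE]]] := qG m; have := yq m isT; rewrite qE => /vlineP[b ->].
  exists [tuple b *: tnth t ord0; tnth t 1; tnth t ord_max].
  by rewrite wedgev3 -wedge3Zl.
exists (fun m => tnth (t m) ord0), (fun m => tnth (t m) 1), (fun m => tnth (t m) ord_max).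
by apply: eq_bigr.
Qed.

Lemma vanishes_on_secants (Q : {mpoly K[N]}) :
  vanishes_on Q secant_points <-> (forall w, cone w -> peval Q w = 0).
Proof.
split=> [QS w /cone_secant_points[p pS wp]|Qc p pS w wp]; first exact: QS wp.
exact/Qc/(secant_points_cone pS wp).
Qed.

(** Both the points and the ideal of the closure are determined by the polynomials
   that vanish on the secant planes, and these are the multiples of Q. *)
Lemma equation_hypersurface (Q : {mpoly K[N]}) a p : equation Q a p ->
  hypersurface_with_equation (secant_variety 3 Gr) Q.
Proof.
move=> eqQ; have Qc := proj2 (vanishes_on_secants Q) (equation_cone eqQ).
have dvdQ B : vanishes_on B secant_points -> exists S, B = S * Q.
  by move/vanishes_on_secants/(equation_dvd eqQ).
have multiple S pt : vanishes_at Q pt -> vanishes_at (S * Q) pt.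
  by move=> Q0 v vp; rewrite /peval mevalM -/(peval Q v) Q0 // mulr0.
have secantE pt : secant_variety 3 Gr pt <-> vanishes_at Q pt.
  split=> [/(_ _ _ (equation_homog eqQ))|Q0 d B _ /dvdQ[S ->]]; first exact.
  exact: multiple.
split.
- by apply: contraNneq (equation_fano eqQ) => ->; rewrite /peval meval0.
- by exists 7; last exact: (equation_homog eqQ).
- exact: secantE.
- move=> B; split=> [BX|[S -> pt /secantE]]; last exact: multiple.
  by apply: dvdQ => pt ptS; apply: BX => d C _; apply.
Qed.

End SecantVariety.

Theorem theorem1p2 (R : realType) :
  exists P7 : {mpoly R[i][#|{: ksub 7 3}|]},
    [/\ P7 \is 7.-homog,
        (forall (g : 'M[R[i]]_7) (w : ext R[i] 7 3),
           \det g = 1 -> peval P7 (extmap g w) = peval P7 w),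
        hypersurface_with_equation
          (secant_variety 3 (@grassmannian R[i] 7 3)) P7
      & forall w : ext R[i] 7 3,
          \det (phi_gram w) = 2 * peval P7 w ^+ 3].
Proof.
have [Q [a [p eqQ]]] := ex_equation R[i].
exists Q; split.
- exact: equation_homog eqQ.
- by move=> g w; apply: equation_SL eqQ g w.
- exact: equation_hypersurface eqQ.
- by case: eqQ.
Qed.
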